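(* Let $z_0\in(0,1)$, $K>0$, $0<\beta_*<\beta^*\le 1$ and $\lambda>K+e\sqrt{4+\frac{4}{2\beta_*+1}}$ be fixed. Then for all $0<\varepsilon<1$, the sequential adaptive estimator $\widehat S_n$ defined in the context satisfies $$\limsup_{n\to\infty}\ \mathcal{R}_n(\widehat S_n)<\infty,$$ where $\mathcal{R}_n$ is the adaptive risk defined in the context.
   Context: Model: one observes $y_1,\dots,y_n$ given by $y_k=S(x_k)y_{k-1}+\xi_k$, $1\le k\le n$, where $y_0=0$, $x_k=k/n$, and $\xi_1,\dots,\xi_n$ are i.i.d. standard Gaussian random variables. The function $S$ is unknown. $\mathbf{P}_S$ denotes the distribution of $(y_1,\dots,y_n)$ corresponding to $S$, and $\mathbf{E}_S$ the corresponding expectation. Stability set: $\Gamma_\varepsilon=\{S:(0,1]\to\mathbb{R}\ \text{continuously differentiable}: \|S\|\le 1-\varepsilon\}$, where $\|S\|=\sup_{0<x\le 1}|S(x)|$. Stable local Hölder class at $z_0$: for $0<\beta\le 1$, $$\mathcal{H}^{(\beta)}(z_0,K,\varepsilon)=\Big\{S\in\Gamma_\varepsilon:\ \sup_{x\in(0,1],\,x\ne z_0}\frac{|S(x)-S(z_0)|}{|x-z_0|^\beta}\le K\Big\}.$$ Rate and adaptive risk: $N(\beta)=\left(\frac{n}{\ln n}\right)^{\beta/(2\beta+1)}$ and, for an estimator $\tilde S_n$ of $S(z_0)$ (a measurable function of the observations), $$\mathcal{R}_n(\tilde S_n)=\sup_{\beta\in[\beta_*,\beta^*]}\ \sup_{S\in\mathcal{H}^{(\beta)}(z_0,K,\varepsilon)}N(\beta)\,\mathbf{E}_S|\tilde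 S_n(z_0)-S(z_0)|.$$ Sequential kernel estimator with bandwidth $h>0$: let $Q$ be the indicator function of $[-1,1]$, $u_j=(x_j-z_0)/h$, $A_k=\sum_{j=1}^k Q(u_j)y_{j-1}^2$, and for $H>0$ let $$\tau_H=\inf\{1\le k\le n:\ A_k\ge H\}.$$ On the event $\{A_n\ge H\}$ let $\alpha_H\in[0,1]$ be defined by $$\sum_{j=1}^{\tau_H-1}Q(u_j)y_{j-1}^2+\alpha_H\,Q(u_{\tau_H})\,y_{\tau_H-1}^2=H.$$ Define $$S^*_{H,h}(z_0)=\frac1H\Big(\sum_{j=1}^{\tau_H-1}Q(u_j)\,y_{j-1}y_j+\alpha_H\,Q(u_{\tau_H})\,y_{\tau_H-1}y_{\tau_H}\Big)\mathbf{1}_{(A_n\ge H)}$$ (so that it equals $0$ when $A_n<H$). Write $S^*_h=S^*_{H,h}(z_0)$ with the choice $H=nh$. Adaptive selection: let $d_n=n/\ln n$, $h(\beta)=d_n^{-1/(2\beta+1)}$, $m=[\ln d_n]+1$ (where $[\cdot]$ is the integer part), $\beta_k=\beta_*+\frac{k}{m}(\beta^*-\beta_* )$, $N_k=N(\beta_k)$, $h_k=h(\beta_k)$, for $k=0,\dots,m$ (and the same formulas define $\beta_{m+1}$, $N_{m+1}$). For $0\le j\le m$ set $$\omega(h_j)=\max_{0\le k\le j}\Big(|S^*_{h_j}-S^*_{h_k}|-\frac{\lambda}{N_{k+1}}\Big),$$ $$\widehat k=\inf\Big\{0\le j\le m:\ \omega(h_j)\ge\frac{\lambda}{N_j}\Big\}-1,$$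 with the convention that the infimum of the empty set is $m+1$. The adaptive estimator is $\widehat S_n=S^*_{\widehat h}$ with $\widehat h=h_{\widehat k}$. *)

(* Defs.v *)
From HB Require Import structures.
From mathcomp Require Import all_boot all_order all_algebra.
From mathcomp Require Import all_classical all_reals all_analysis.

Set Implicit Arguments.
Unset Strict Implicit.
Unset Printing Implicit Defensive.

Import Order.TTheory GRing.Theory Num.Theory.
Import numFieldNormedType.Exports.

Local Open Scope classical_set_scope.
Local Open Scope ring_scope.

(* [noise 0] and [noise k] for [k > n] are unconstrained.  Taking some of the
   [B k] to be the whole line gives the product rule for every subfamily. *)
Definition iid_std_normal (R : realType) (d : measure_display)
    (T : measurableType d) (P : probability T R) (n : nat)
    (noise : nat -> {RV P >-> R}) : Prop :=
  (forall k, (1 <= k <= n)%N -> forall B : set R, measurable B ->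
     distribution P (noise k) B = normal_prob 0 1 B) /\
  (forall B : nat -> set R, (forall k, measurable (B k)) ->
     P (\bigcap_(k in [set k | (1 <= k <= n)%N]) (noise k @^-1` B k)) =
     (\prod_(1 <= k < n.+1) P (noise k @^-1` B k))%E).

Definition design (R : realType) (n k : nat) : R := k%:R / n%:R.

Fixpoint observation (R : realType) (n : nat) (S : R -> R) (e : nat -> R)
    (k : nat) : R :=
  if k is k'.+1 then S (design R n k) * observation n S e k' + e k else 0.

(* Functions on (0,1] are represented by functions on the whole line whose
   values outside (0,1] are irrelevant.  The limit of the difference quotient
   is taken inside (0,1], hence is one-sided at 1. *)
Definition continuously_differentiable (R : realType) (S : R -> R) : Prop :=
  exists S' : R -> R,
    (forall x : R, x \in `]0, 1] ->
       (fun y => (S y - S x) / (y - x)) @ within [set` `]0, 1]] (x^')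
         --> S' x) /\
    {within [set` `]0, 1]], continuous S'}.

Definition sup_norm (R : realType) (S : R -> R) : \bar R :=
  ereal_sup [set `|S x|%:E | x in [set` `]0, 1]]].

Definition stability_set (R : realType) (eps : R) : set (R -> R) :=
  [set S | continuously_differentiable S /\ (sup_norm S <= (1 - eps)%:E)%E].

Definition holder_quotient_sup (R : realType) (beta z0 : R) (S : R -> R) :
    \bar R :=
  ereal_sup [set (`|S x - S z0| / `|x - z0| `^ beta)%:E
            | x in [set x | x \in `]0, 1] /\ x != z0]].

Definition holder_class (R : realType) (beta z0 K eps : R) : set (R -> R) :=
  [set S | stability_set eps S /\ (holder_quotient_sup beta z0 S <= K%:E)%E].

Definition dn (R : realType) (n : nat) : R := n%:R / ln n%:R.

Definition rate (R : realType) (n : nat) (beta : R) : R :=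
  dn R n `^ (beta / (2 * beta + 1)).

Definition bandwidth (R : realType) (n : nat) (beta : R) : R :=
  dn R n `^ (- (2 * beta + 1)^-1).

(* An estimator [est] maps the observations [y] (with [y 0 = 0]) to an
   estimate of [S z0]. *)
Definition mean_abs_error (R : realType) (d : measure_display)
    (T : measurableType d) (P : probability T R) (n : nat)
    (noise : nat -> {RV P >-> R}) (S : R -> R) (z0 : R)
    (est : (nat -> R) -> R) : \bar R :=
  expectation P
    (fun w => `|est (observation n S (fun k => noise k w)) - S z0|).

Definition adaptive_risk (R : realType) (d : measure_display)
    (T : measurableType d) (P : probability T R) (n : nat)
    (noise : nat -> {RV P >-> R}) (z0 K eps beta_lo beta_hi : R)
    (est : (nat -> R) -> R) : \bar R :=
  ereal_sup
    [set ereal_sup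
       [set ((rate n beta)%:E * mean_abs_error n noise S z0 est)%E
       | S in holder_class beta z0 K eps]
    | beta in [set` `[beta_lo, beta_hi]]].

(* The least [i] with [m <= i <= n] and [p i]; [n.+1] if there is none
   (for [m <= n.+1]). *)
Definition first_in (m n : nat) (p : pred nat) : nat :=
  (m + find p (iota m (n.+1 - m)))%N.

Section SequentialEstimator.
Variables (R : realType) (n : nat) (z0 h H : R) (y : nat -> R).

Definition Qu (j : nat) : R := \1_(`[-1, 1]%classic) ((design R n j - z0) / h).

Definition A (k : nat) : R := \sum_(1 <= j < k.+1) Qu j * y j.-1 ^+ 2.

Definition tau : nat := first_in 1 n (fun k => H <= A k).

(* For [0 < H <= A n] exactly one number satisfies this condition. *)
Definition alpha : R :=
  xget 0 [set a | 0 <= a <= 1 /\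
    \sum_(1 <= j < tau) Qu j * y j.-1 ^+ 2 + a * Qu tau * y tau.-1 ^+ 2 = H].

Definition Sstar : R :=
  if H <= A n then
    H^-1 * (\sum_(1 <= j < tau) Qu j * y j.-1 * y j
            + alpha * Qu tau * y tau.-1 * y tau)
  else 0.

End SequentialEstimator.

Section AdaptiveEstimator.
Variables (R : realType) (n : nat) (z0 beta_lo beta_hi lambda : R).
Variable y : nat -> R.

Definition Sstar_h (h : R) : R := Sstar n z0 h (n%:R * h) y.

Definition grid_size : nat := (Num.truncn (ln (dn R n))).+1.

Definition beta_ (k : nat) : R :=
  beta_lo + k%:R / grid_size%:R * (beta_hi - beta_lo).

Definition N_ (k : nat) : R := rate n (beta_ k).

Definition h_ (k : nat) : R := bandwidth n (beta_ k).

Definition deviation (j k : nat) : R :=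
  `|Sstar_h (h_ j) - Sstar_h (h_ k)| - lambda / N_ k.+1.

(* The unit of [max] is the term at [k = 0], so this is the maximum over
   [0 <= k <= j]. *)
Definition omega (j : nat) : R :=
  \big[Num.max/deviation j 0]_(0 <= k < j.+1) deviation j k.

(* The predecessor is never applied to 0 when [lambda > 0] and [n >= 2], since
   then [omega 0 < 0 < lambda / N_ 0]. *)
Definition khat : nat :=
  (first_in 0 grid_size (fun j => lambda / N_ j <= omega j)).-1.

Definition adaptive_estimator : R := Sstar_h (h_ khat).

End AdaptiveEstimator.

(* Main.v *)
Require Import Defs.
From HB Require Import structures.
From mathcomp Require Import all_boot all_order all_algebra.
From mathcomp Require Import all_classical all_reals all_analysis.
From mathcomp Require Import measurable_realfun.
From mathcomp Require Import ring lra.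
Import Order.TTheory GRing.Theory Num.Theory.
Import numFieldNormedType.Exports.
Set Implicit Arguments.
Unset Strict Implicit.
Unset Printing Implicit Defensive.
Local Open Scope classical_set_scope.
Local Open Scope ring_scope.

(** Why the theorem holds.

    Each fixed-bandwidth estimator is a stopped sum, and stopping normalizes
    it.  On the event [H <= A n] its error splits into a bias of at most
    [K * h ^ beta], since the weights add up to [H], and a noise term
    [stopped_noise / H].  Here [stopped_noise] is a martingale whose increments
    are, given the past, centred Gaussian with conditional variances of total at
    most [H] ([Sstar_error], [sum_stopped_weight_sqr]).  Hence [stopped_noise / sqrt H] is sub-Gaussian
    uniformly in [S] ([stopped_noise_abs_mgf]).  The choice [H = n h] turns
    [sqrt H] into [sqrt (ln n) * rate], so on the grid the error of the [k]-th
    estimator is at most [K * h_k ^ beta + Z_k / sqrt (ln n) / N_k] with [Z_k]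
    sub-Gaussian ([Sstar_h_error]).

    The event [A n < n h] is exponentially unlikely: a Gaussian with unit
    variance and any mean satisfies [E exp (- Y ^ 2 / 2) <= 2 ^ (- 1 / 2)], so
    conditioning step by step bounds the Laplace transform of [A n] by the
    power [- 1 / 2] of 2 per design point in the window, and the window holds
    about [2 n h] points.  This beats [exp (- n h / 2)] because [ln 2 > 1 / 2]
    ([A_laplace], [window_count], [A_deficit]).  Both exponential bounds come
    from one supermartingale inequality ([exp_supermartingale]), which is
    Fubini's theorem for a random variable independent of the past
    ([integral_past_noise]).

    Write [lambda = K + e r].  Call an outcome good if for every grid index
    [n h_k <= A n] and [Z_k < r * sqrt (ln n)].  On a good outcome Lepski's
    argument is deterministic ([lepski_oracle]): up to the index [i] with
    [beta_i <= beta <= beta_(i+1)] no comparison exceeds its threshold, so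
    [khat >= i], and the acceptance test at [khat] keeps the selected estimator
    within [2 lambda / N_i] of the [i]-th one.  The factor [e] in the condition
    on [lambda] is the bound on [N_(k+1) / N_k] ([N_close]), which is also what
    makes the grid fine enough to replace [rate beta] by [N_i].

    A bad outcome has probability at most of order [(m + 1) / n ^ 2]: for the
    noise because [r ^ 2 >= 4] gives [exp (- r ^ 2 * ln n / 2) <= n ^ (- 2)],
    for the energy because [n h_k / ln n] tends to infinity.  There the
    error is at most [1 + K + Z_khat], and
    [Z <= n + Z ^ 2 / n <= n + 4 exp Z / n].  Bounding indicators by
    exponentials replaces the risk by the expectation of an explicit finite
    sum of exponentials ([risk_dominated], [dominating_mean_le]), and since
    [rate beta * (m + 1) = O(n)] the total stays bounded ([risk_le]). *)

(** * Integration and superior limits *)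

Section integral_aux.
Local Open Scope ereal_scope.

(** The integral of a nonnegative function is a supremum over the simple
    functions below it, hence monotone for arbitrary functions.  This is what
    bounds the risk of the adaptive estimator, which is defined by random
    indices and a choice operator, by the integral of a measurable function. *)
Lemma le_integral_ge0 d (T : measurableType d) (R : realType)
    (mu : {measure set T -> \bar R}) (f g : T -> \bar R) :
  (forall x, 0 <= f x) -> (forall x, f x <= g x) ->
  \int[mu]_x f x <= \int[mu]_x g x.
Proof.
move=> f0 fg; have g0 x : 0 <= g x by exact: le_trans (fg x).
rewrite !ge0_integralTE//; apply: le_ereal_sup => _ [h hf <-].
by exists h => // x; exact: le_trans (fg x).
Qed.

Lemma limn_esup_lty (R : realType) (u : nat -> \bar R) (C : R) :
  (\forall n \near \oo, u n <= C%:E) -> limn_esup u < +oo.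
Proof.
move=> uC; apply: (@le_lt_trans _ _ C%:E); last exact: ltry.
apply: (@le_trans _ _ (ereal_sup (u @` [set n | u n <= C%:E]))).
  by apply: ereal_inf_lbound; exists [set n | u n <= C%:E].
by apply: ge_ereal_sup => _ [n /= un <-].
Qed.

End integral_aux.

(** * Gaussian integrals *)

Section gaussian.
Variable R : realType.
Local Notation mu := (@lebesgue_measure R).
Local Notation N01 := (normal_prob (0 : R) 1).

(** The density of [normal_prob] is by definition its Radon-Nikodym derivative
    up to a null set, so integrals transfer through that derivative. *)
Lemma integral_normal_prob (f : R -> \bar R) :
  measurable_fun setT f -> (forall x, 0 <= f x)%E ->
  (\int[N01]_x f x = \int[mu]_x (f x * (normal_pdf 0 1 x)%:E))%E.
Proof.
move=> mf f0.
have numu := normal_prob_dominates (0 : R) 1.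
rewrite -(Radon_Nikodym_SigmaFinite.change_of_variables numu)//.
have mg := measurable_int _ (Radon_Nikodym_SigmaFinite.f_integrable numu).
have mp : measurable_fun setT (fun x : R => (normal_pdf 0 1 x)%:E).
  by apply/measurable_EFinP; exact: measurable_normal_pdf.
apply: ae_eq_integral => //.
- exact: emeasurable_funM.
- exact: emeasurable_funM.
- apply: ae_eqe_mul2l; apply: integral_ae_eq => //.
  + exact: Radon_Nikodym_SigmaFinite.f_integrable.
  + by move=> A _ mA; rewrite -Radon_Nikodym_SigmaFinite.f_integral.
Qed.

(** Completing the square turns the integrand into the density of the normal
    law with mean [t]. *)
Lemma normal_mgf (t : R) :
  (\int[N01]_x (expR (t * x - t ^+ 2 / 2))%:E = 1)%E.
Proof.
rewrite integral_normal_prob//; last first.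
  apply/measurable_EFinP; apply: measurableT_comp => //.
  by apply: measurable_funB => //; exact: measurable_funM.
rewrite -[RHS](integral_normal_pdf t 1); apply: eq_integral => x _.
rewrite -EFinM; congr EFin; rewrite !normal_pdfE ?oner_eq0//.
rewrite mulrCA; congr *%R; rewrite /normal_fun -expRD; congr expR.
by field.
Qed.

(** Completing the square gives the density with mean [- a / 2] and variance
    1/2, times [sqrt (1 / 2) * exp (- a ^ 2 / 4)].  The bound [2 ^ (- 1 / 2)]
    is uniform in [a], which is why the unknown regression function disappears
    from the lower bound on [A n]. *)
Lemma normal_laplace_square (a : R) :
  (\int[N01]_x (expR (- (2^-1 * (a + x) ^+ 2)))%:E <= (expR (- (ln 2 / 2)))%:E)%E.
Proof.
set s := Num.sqrt (2^-1 : R).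
have s2 : s ^+ 2 = 2^-1 by rewrite sqr_sqrtr// invr_ge0.
have s0 : s != 0 by rewrite sqrtr_eq0 -ltNge invr_gt0.
have -> : expR (- (ln 2 / 2)) = s.
  apply/eqP; rewrite -(@eqrXn2 _ 2)// ?expR_ge0 ?sqrtr_ge0// s2.
  by rewrite expr2 -expRD -opprD -splitr expRN lnK ?posrE.
rewrite integral_normal_prob//; last first.
  apply/measurable_EFinP; apply: measurableT_comp => //.
  apply: measurableT_comp => //; apply: measurable_funM => //.
  by apply: measurable_funX; exact: measurable_funD.
rewrite -[leRHS]mule1 -(integral_normal_pdf (- a / 2) s).
rewrite -ge0_integralZl//; last 3 first.
- by apply/measurable_EFinP; exact: measurable_normal_pdf.
- by move=> x _; rewrite lee_fin normal_pdf_ge0.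
- by rewrite lee_fin sqrtr_ge0.
apply: le_integral_ge0 => x.
  by rewrite -EFinM lee_fin mulr_ge0 ?expR_ge0 ?normal_pdf_ge0.
rewrite -!EFinM lee_fin !normal_pdfE ?oner_eq0//.
have -> : normal_peak 1 = s * normal_peak s :> R.
  rewrite /normal_peak s2 expr1n mul1r -mulrnAr sqrtrM ?invr_ge0// -/s.
  by rewrite invfM mulrA divff// mul1r.
rewrite mulrCA -mulrA ler_wpM2l ?sqrtr_ge0//.
rewrite ler_wpM2l ?normal_peak_ge0// /normal_fun -expRD ler_expR s2.
have := sqr_ge0 a; rewrite expr1n; lra.
Qed.

End gaussian.

(** * The filtration of the noise and exponential supermartingales *)

Section filtration.
Context (R : realType) (d : measure_display) (T : measurableType d).
Variables (P : probability T R) (noise : nat -> {RV P >-> R}).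

(** These sets generate the sigma-algebra of the first [k] noise variables.
    Rectangles rather than single preimages are taken because they are stable
    under intersection, so that measures are determined by them. *)
Definition past_rectangles (k : nat) : set (set T) :=
  [set A | exists B : nat -> set R, (forall i, measurable (B i)) /\
     A = \bigcap_(i in [set i | (1 <= i <= k)%N]) (noise i @^-1` B i)].

Definition past (k : nat) : measurableType _ :=
  g_sigma_algebraType (past_rectangles k).

Lemma past_rectangles_setI k : setI_closed (past_rectangles k).
Proof.
move=> _ _ [B [mB ->]] [C [mC ->]].
exists (fun i => B i `&` C i); split; first by move=> i; exact: measurableI.
by rewrite -bigcapI; apply: eq_bigcapr => i _; rewrite preimage_setI.
Qed.

Lemma past_rectangles_setT k : past_rectangles k setT.
Proof.
exists (fun=> setT); split => //; apply/esym.
by under eq_bigcapr do rewrite preimage_setT; rewrite bigcapT.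
Qed.

Lemma past_rectangles_measurable k : past_rectangles k `<=` measurable.
Proof.
move=> _ [B [mB ->]]; apply: bigcap_measurableType => i _.
by rewrite -[_ @^-1` _]setTI; exact: measurable_funP.
Qed.

Lemma past_measurable k (A : set T) :
  measurable (A : set (past k)) -> measurable A.
Proof.
move=> mA; have : <<s past_rectangles k >> A := mA.
apply: smallest_sub; first exact: sigma_algebra_measurable.
exact: past_rectangles_measurable.
Qed.

Lemma past_homo k l (A : set T) : (k <= l)%N ->
  measurable (A : set (past k)) -> measurable (A : set (past l)).
Proof.
move=> kl; apply: sub_smallest2r => // _ [B [mB ->]].
exists (fun i => if (i <= k)%N then B i else setT); split.
  by move=> i; case: ifP.
apply/seteqP; split => w /= Bw i /= /andP[i1 ik].
  by case: ifPn => // ik'; apply: Bw => /=; rewrite i1.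
by have := Bw i; rewrite /= ik i1 (leq_trans ik kl); exact.
Qed.

Lemma measurable_past_homo k l d' (U : measurableType d') (f : T -> U) :
  (k <= l)%N -> measurable_fun setT (f : past k -> U) ->
  measurable_fun setT (f : past l -> U).
Proof. by move=> kl mf _ Y mY; apply: (past_homo kl); exact: mf. Qed.

Lemma measurable_past_fun k d' (U : measurableType d') (f : T -> U) :
  measurable_fun setT (f : past k -> U) -> measurable_fun setT f.
Proof. by move=> mf _ Y mY; apply: (@past_measurable k); exact: mf. Qed.

Lemma measurable_noise_past k i : (1 <= i <= k)%N ->
  measurable_fun setT (noise i : past k -> R).
Proof.
move=> ik _ Y mY; rewrite setTI; apply: sub_sigma_algebra.
exists (fun j => if j == i then Y else setT); split.
  by move=> j; case: ifP.
apply/seteqP; split => w /=.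
  by move=> Yw j _ /=; case: eqP => // ->.
by move=> /(_ i ik) /=; rewrite eqxx.
Qed.

Lemma measurable_id_past k : measurable_fun setT (id : T -> past k).
Proof. by move=> _ Y mY; rewrite setTI; exact: (@past_measurable k). Qed.

Variable n : nat.
Hypothesis iid : iid_std_normal n noise.

(** Both sides are finite measures in [A]; they agree on rectangles by the
    product rule, hence on the generated sigma-algebra. *)
Lemma past_independent k (A : set T) (B : set R) : (k < n)%N ->
  measurable (A : set (past k)) -> measurable B ->
  P (A `&` noise k.+1 @^-1` B) = (P A * normal_prob 0 1 B)%E.
Proof.
move=> kn mA mB; have [law ind] := iid.
have mNB : measurable (noise k.+1 @^-1` B).
  by rewrite -[_ @^-1` _]setTI; exact: measurable_funP.
have PB : P (noise k.+1 @^-1` B) = normal_prob 0 1 B by rewrite -(law k.+1).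
have PBfin : P (noise k.+1 @^-1` B) \is a fin_num by exact: fin_num_measure.
rewrite -PB.
pose c := NngNum (fine_ge0 (measure_ge0 P (noise k.+1 @^-1` B))).
pose m1 : {measure set T -> \bar R} := mrestr P mNB.
pose m2 : {measure set T -> \bar R} := mscale c P.
rewrite -[LHS]/(m1 A) muleC -[in RHS](fineK PBfin) -[RHS]/(m2 A).
apply: (g_sigma_algebra_measure_unique (past_rectangles k)
  (@past_rectangles_measurable k) (fun=> setT)) => //.
- by move=> _; exact: past_rectangles_setT.
- by rewrite bigcup_const.
- exact: past_rectangles_setI.
- move=> _ [C [mC ->]]; set D := \bigcap_(i in _) _.
  rewrite [LHS](_ : _ = P (D `&` noise k.+1 @^-1` B))//.
  rewrite [RHS](_ : _ = P (noise k.+1 @^-1` B) * P D)%E; last first.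
    by rewrite -[in RHS](fineK PBfin).
  rewrite /D {D}.
  (* Both rectangles over [1..k] are written as rectangles over [1..n], where
     the product rule is available; they differ only in the factor [k.+1]. *)
  pose B' i := if (i <= k)%N then C i else if i == k.+1 then B else setT.
  pose C' i := if (i <= k)%N then C i else setT.
  have mB' i : measurable (B' i) by rewrite /B'; do ?case: ifP.
  have mC' i : measurable (C' i) by rewrite /C'; do ?case: ifP.
  have -> : \bigcap_(i in [set i | (1 <= i <= k)%N]) noise i @^-1` C i
      `&` noise k.+1 @^-1` B =
      \bigcap_(i in [set i | (1 <= i <= n)%N]) noise i @^-1` B' i.
    apply/seteqP; split => w /=.
      move=> [Cw Bw] i /= /andP[i1 _]; rewrite /B'; case: ifPn => ik.
        by apply: Cw; rewrite /= i1.
      by case: eqP => // ->.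
    move=> B'w; split => [i /= /andP[i1 ik]|].
      have := B'w i; rewrite /= /B' ik i1; apply.
      by rewrite (leq_trans ik)// ltnW.
    by have := B'w k.+1; rewrite /= /B' ltnn eqxx; exact.
  have -> : \bigcap_(i in [set i | (1 <= i <= k)%N]) noise i @^-1` C i =
      \bigcap_(i in [set i | (1 <= i <= n)%N]) noise i @^-1` C' i.
    apply/seteqP; split => w /= Cw i /= /andP[i1 ik].
      by rewrite /C'; case: ifPn => // ik'; apply: Cw; rewrite /= i1.
    have := Cw i; rewrite /= /C' ik i1; apply.
    by rewrite (leq_trans ik)// ltnW.
  rewrite !ind//.
  have kin : k.+1 \in index_iota 1 n.+1 by rewrite mem_index_iota.
  rewrite (bigD1_seq _ kin) ?iota_uniq//= [in RHS](bigD1_seq _ kin) ?iota_uniq//=.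
  rewrite {1}/B' {1}/C' ltnn eqxx preimage_setT probability_setT mul1e.
  congr (_ * _)%E; apply: eq_bigr => i /negbTE ik.
  by rewrite /B' /C' ik.
- move=> _; rewrite [ltLHS](_ : _ = P (setT `&` noise k.+1 @^-1` B))//.
  by rewrite setTI ltey_eq PBfin.
Qed.

(** Independence makes the joint law of the past and of the next noise variable
    a product measure; the integral of [f] against it is then iterated. *)
Lemma integral_past_noise k (f : T * R -> \bar R) : (k < n)%N ->
  measurable_fun setT (f : past k * R -> \bar R) -> (forall z, 0 <= f z)%E ->
  (\int[P]_w f (w, noise k.+1 w) =
   \int[P]_w \int[normal_prob 0 1]_x f (w, x))%E.
Proof.
move=> kn mf f0; pose X := noise k.+1.
(* The normal law lives on the Borel structure generated by half-open
   intervals; naming it keeps the product structures syntactically equal. *)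
pose RT : measurableType _ := measurableTypeR R.
have mf' : measurable_fun setT (f : past k * RT -> \bar R) by exact: mf.
have mX : measurable_fun setT (X : T -> RT).
  have h : measurable_fun setT X by exact: measurable_funP.
  exact: h.
have mid := @measurable_id_past k.
have mpair : measurable_fun setT ((fun w => (w, X w)) : T -> past k * RT).
  exact: measurable_fun_pair.
pose m1 : probability (past k) R := distribution P (mfun_Sub (mem_set mid)).
pose mXY : probability (past k * RT)%type R := distribution P (mfun_Sub (mem_set mpair)).
have E A : measurable A -> (m1 \x normal_prob 0 1)%E A = mXY A.
  have := @product_measure_unique _ _ (past k) _ R m1 (normal_prob 0 1) mXY.
  apply => // A1 A2 mA1 mA2.
  exact: past_independent.
have H1 : (\int[P]_w f (w, X w) = \int[mXY]_z f z)%E.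
  by rewrite ge0_integral_pushforward.
rewrite {}H1 -(eq_measure_integral mXY (m1 := (m1 \x normal_prob 0 1)%E)); last first.
  by move=> A mA _; exact: E.
rewrite fubini_tonelli1// /fubini_F ge0_integral_pushforward//.
- exact: measurable_fun_fubini_tonelli_F.
- by move=> w _; exact: integral_ge0.
Qed.

Lemma measurable_past_eval j d' (U : measurableType d') (g : T * R -> U) :
  measurable_fun setT (g : past j * R -> U) ->
  measurable_fun setT ((fun w => g (w, noise j.+1 w)) : past j.+1 -> U).
Proof.
move=> mg; apply: (@measurableT_comp _ _ _ _ _ _ (g : past j * R -> U) _
    ((fun w => (w, noise j.+1 w)) : past j.+1 -> past j * R)) => //.
apply: measurable_fun_pair; last by apply: measurable_noise_past; rewrite /= leqnn.
by move=> _ Y mY; rewrite setTI; exact: (@past_homo j).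
Qed.

Lemma measurable_past_sum (G : nat -> T * R -> R) k :
  (forall j, (j < k)%N -> measurable_fun setT (G j : past j * R -> R)) ->
  measurable_fun setT
    ((fun w => \sum_(j < k) G j (w, noise j.+1 w)) : past k -> R).
Proof.
move=> mG; apply: measurable_sum => j.
apply: (@measurable_past_homo j.+1); first exact: ltn_ord.
by apply: measurable_past_eval; exact: mG.
Qed.

(** Conditionally on the past the [j]-th factor has mean at most
    [exp (kappa j)].  Peeling off the last factor, the others being measurable
    with respect to the past, gives the bound by induction. *)
Lemma exp_supermartingale (G : nat -> T * R -> R) (kappa : nat -> R) k :
  (k <= n)%N ->
  (forall j, (j < k)%N -> measurable_fun setT (G j : past j * R -> R)) ->
  (forall j w, (j < k)%N ->
    \int[normal_prob 0 1]_x (expR (G j (w, x)))%:E <= (expR (kappa j))%:E)%E ->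
  (\int[P]_w (expR (\sum_(j < k) G j (w, noise j.+1 w)))%:E
   <= (expR (\sum_(j < k) kappa j))%:E)%E.
Proof.
elim: k => [|k IH] kn mG Gk.
  under eq_integral do rewrite big_ord0 expR0.
  by rewrite big_ord0 expR0 integral_cst//= mul1e probability_setT.
pose M w := \sum_(j < k) G j (w, noise j.+1 w).
have mM : measurable_fun setT (M : past k -> R).
  by apply: measurable_past_sum => j jk; apply: mG; rewrite ltnW// ltnS.
pose f (z : T * R) : \bar R := (expR (M z.1) * expR (G k z))%:E.
have mf : measurable_fun setT (f : past k * R -> \bar R).
  apply/measurable_EFinP; apply: measurable_funM.
    apply: measurableT_comp => //.
    apply: (@measurableT_comp _ _ _ _ _ _ (M : past k -> R) _
      (fst : past k * R -> past k)); first exact: mM.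
    exact: measurable_fst.
  apply: (@measurableT_comp _ _ _ _ _ _ expR _ (G k : past k * R -> R)) => //.
  exact: mG.
have f0 z : (0 <= f z)%E by rewrite lee_fin mulr_ge0 ?expR_ge0.
under eq_integral do rewrite big_ord_recr/= expRD -[(_ * _)%:E]/(f (_, _)).
rewrite integral_past_noise//.
apply: (@le_trans _ _ (\int[P]_w ((expR (M w))%:E * (expR (kappa k))%:E))%E).
  apply: le_integral_ge0 => w; first exact: integral_ge0.
  rewrite /f /=; under eq_integral do rewrite EFinM.
  rewrite ge0_integralZl ?lee_fin ?expR_ge0//; last first.
    have h : measurable_fun setT (fun x : R => (expR (G k (w, x)))%:E).
      apply/measurable_EFinP; apply: measurableT_comp => //.
      apply: (@measurableT_comp _ _ _ _ _ _ (G k : past k * R -> R) _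
        ((fun x => (w, x)) : R -> past k * R)); first exact: mG.
      exact: measurable_fun_pair.
    exact: h.
  by rewrite lee_wpmul2l ?lee_fin ?expR_ge0// Gk.
rewrite ge0_integralZr ?lee_fin ?expR_ge0//; last first.
  apply/measurable_EFinP; apply: measurableT_comp => //.
  exact: (@measurable_past_fun k).
rewrite big_ord_recr/= expRD EFinM lee_wpmul2r ?lee_fin ?expR_ge0//.
by apply: IH => [|j jk|j w jk]; [exact: ltnW|apply: mG|apply: Gk]; rewrite ltnW// ltnS.
Qed.

End filtration.

(** * The sequential estimator with explicit weights *)

Section stopped_weights.
Variables (R : realType) (n : nat) (z0 h H : R) (y : nat -> R).
Hypothesis H_gt0 : 0 < H.
Local Notation Q := (Qu n z0 h).
Local Notation A := (A n z0 h y).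

Lemma Qu_ge0 j : 0 <= Q j.
Proof. by rewrite /Qu indicE ler0n. Qed.

Lemma Qu_idem j : Q j * Q j = Q j.
Proof. by rewrite /Qu indicE; case: (_ \in _); rewrite ?mulr1 ?mulr0. Qed.

Lemma Qu_le1 j : Q j <= 1.
Proof. by rewrite /Qu indicE; case: (_ \in _). Qed.

Lemma A_rec k : A k.+1 = A k + Q k.+1 * y k ^+ 2.
Proof. by rewrite /Defs.A big_nat_recr. Qed.

Lemma A_at0 : A 0 = 0.
Proof. by rewrite /Defs.A big_geq. Qed.

Lemma A_homo k l : (k <= l)%N -> A k <= A l.
Proof.
move=> /subnK <-; elim: (l - k)%N => [//|i IH].
by rewrite addSn A_rec (le_trans IH)// lerDl mulr_ge0 ?Qu_ge0 ?sqr_ge0.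
Qed.

(** The part of the energy [Q * y ^ 2] of step [j.+1] that is used before the
    total reaches [H]: all of it before [tau], the fraction [alpha] at [tau],
    nothing afterwards.  This form involves neither [tau] nor [alpha], and shows
    that the weight of the noise [j.+1] depends only on [y 0], ..., [y j]. *)
Definition stopped_increment (j : nat) : R :=
  Num.min H (A j.+1) - Num.min H (A j).

Definition stopped_weight (j : nat) : R := stopped_increment j / y j.

Lemma stopped_increment_ge0 j : 0 <= stopped_increment j.
Proof.
rewrite subr_ge0 le_min ge_min lexx/= ge_min (A_homo (leqnSn j)) orbT//.
Qed.

Lemma stopped_increment_le j : stopped_increment j <= Q j.+1 * y j ^+ 2.
Proof.
have := A_homo (leqnSn j); rewrite /stopped_increment A_rec.
by case: (leP H (A j)); case: (leP H (A j + _)); lra.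
Qed.

Lemma sum_stopped_increment k : \sum_(j < k) stopped_increment j = Num.min H (A k).
Proof.
rewrite -(big_mkord xpredT) telescope_sumr// A_at0.
by rewrite (min_idPr (ltW H_gt0)) subr0.
Qed.

Lemma mul_sqr_div (x z : R) : x * z ^+ 2 / z = x * z.
Proof.
by have [->|z0'] := eqVneq z 0; [rewrite expr0n/= !mulr0 mul0r|field].
Qed.

(** If [y j = 0] the quotient is 0, but then so is the increment. *)
Lemma stopped_weightM j : stopped_weight j * y j = stopped_increment j.
Proof.
rewrite /stopped_weight; have [yj|yj] := eqVneq (y j) 0; last by rewrite divfK.
rewrite yj mulr0; apply/esym/le_anti; rewrite stopped_increment_ge0.
by rewrite (le_trans (stopped_increment_le j))// yj expr0n mulr0.
Qed.

(** The square of the weight is the increment times [increment / y ^ 2], and the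
    last ratio is at most [Q <= 1]. *)
Lemma stopped_weight_sqr j : stopped_weight j ^+ 2 <= stopped_increment j.
Proof.
have [yj|yj] := eqVneq (y j) 0.
  by rewrite /stopped_weight yj invr0 mulr0 expr0n stopped_increment_ge0.
have y2 : 0 < y j ^+ 2 by rewrite exprn_even_gt0.
rewrite -(ler_pM2r y2) -exprMn stopped_weightM.
rewrite expr2 ler_wpM2l ?stopped_increment_ge0//.
rewrite (le_trans (stopped_increment_le j))// ler_piMl ?sqr_ge0 ?Qu_le1//.
Qed.

(** The quadratic variation of the stopped noise is bounded by a constant,
    whatever the regression function: this is what stopping is for. *)
Lemma sum_stopped_weight_sqr : \sum_(j < n) stopped_weight j ^+ 2 <= H.
Proof.
apply: (@le_trans _ _ (\sum_(j < n) stopped_increment j)).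
  by apply: ler_sum => j _; exact: stopped_weight_sqr.
by rewrite sum_stopped_increment ge_min lexx.
Qed.

Lemma Sstar_stopped : H <= A n ->
  Sstar n z0 h H y = H^-1 * \sum_(j < n) stopped_weight j * y j.+1.
Proof.
move=> HA; rewrite /Sstar HA; congr *%R.
pose p k := H <= A k.
have n_gt0 : (0 < n)%N.
  rewrite lt0n; apply: contraTneq HA => n0.
  by rewrite [X in Defs.A _ _ _ _ X]n0 A_at0 -ltNge.
have hasp : has p (iota 1 n).
  by apply/hasP; exists n; rewrite // mem_iota n_gt0 add1n ltnSn.
(* The stopping time is [t.+1], as the search starts at 1. *)
set t := find p (iota 1 n).
have tn : (t < n)%N by have := hasp; rewrite has_find size_iota.
have tauE : tau n z0 h H y = t.+1 by rewrite /tau /first_in subSS subn0 add1n.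
have At1 : H <= A t.+1 by have := nth_find 0%N hasp; rewrite nth_iota.
have At k : (k <= t)%N -> A k < H.
  case: k => [_|k kt]; first by rewrite A_at0.
  have := before_find 0%N kt; rewrite nth_iota ?(ltn_trans kt)// add1n /p.
  by move/negbT; rewrite -ltNge.
rewrite tauE.
have : 0 <= alpha n z0 h H y <= 1 /\
    A t + alpha n z0 h H y * Q t.+1 * y t ^+ 2 = H.
  rewrite /alpha tauE; apply: (@xgetPex _ 0
    [set a | 0 <= a <= 1 /\ A t + a * Q t.+1 * y t ^+ 2 = H]).
  have := At1; rewrite A_rec; set D := Q t.+1 * y t ^+ 2 => HD.
  have D0 : 0 < D by have := At t (leqnn t); lra.
  exists ((H - A t) / D); split; last by rewrite -mulrA divfK ?gt_eqF//; ring.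
  by rewrite divr_ge0 ?ler_pdivrMr ?(ltW D0)//=; have := At t (leqnn t); lra.
move: (alpha n z0 h H y) => a [_ aH].
rewrite -(big_mkord xpredT (fun j => stopped_weight j * y j.+1)).
rewrite [RHS](big_cat_nat _ (n := t.+1))//=.
have -> : \sum_(t.+1 <= j < n) stopped_weight j * y j.+1 = 0.
  rewrite big_nat_cond big1// => j /andP[/andP[tj _] _].
  have Hj := le_trans At1 (A_homo tj).
  have Hj1 := le_trans Hj (A_homo (leqnSn j)).
  by rewrite /stopped_weight /stopped_increment !(min_idPl _) // subrr !mul0r.
rewrite addr0.
rewrite [RHS]big_nat_recr//= big_add1/=; congr (_ + _).
  apply: eq_big_nat => j /= jt; congr (_ * _).
  rewrite /stopped_weight /stopped_increment !(min_idPr _) ?(ltW (At _ _))// 1?ltnW//.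
  by rewrite A_rec addrAC subrr add0r mul_sqr_div.
congr (_ * _); rewrite /stopped_weight /stopped_increment (min_idPl At1).
by rewrite (min_idPr (ltW (At t (leqnn t)))) -{1}aH addrAC subrr add0r mul_sqr_div.
Qed.

End stopped_weights.

(** The increments are nonnegative, vanish outside the window and add up to
    [H], so the signal part is a weighted mean of the values of [S] on the
    window. *)
Lemma Sstar_error (R : realType) (n : nat) (z0 h H b : R) (S : R -> R) (e : nat -> R) :
  let y := observation n S e in
  0 < H -> H <= A n z0 h y n ->
  (forall j, (1 <= j <= n)%N -> Qu n z0 h j != 0 -> `|S (design R n j) - S z0| <= b) ->
  `|Sstar n z0 h H y - S z0|
    <= b + H^-1 * `|\sum_(j < n) stopped_weight n z0 h H y j * e j.+1|.
Proof.
move=> y H0 HA Sb; rewrite Sstar_stopped//.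
have sumH : \sum_(j < n) stopped_increment n z0 h H y j = H.
  by rewrite sum_stopped_increment// (min_idPl HA).
have -> : H^-1 * (\sum_(j < n) stopped_weight n z0 h H y j * y j.+1) - S z0
  = H^-1 * (\sum_(j < n) stopped_increment n z0 h H y j * (S (design R n j.+1) - S z0))
  + H^-1 * \sum_(j < n) stopped_weight n z0 h H y j * e j.+1.
  have Sz : S z0 = H^-1 * \sum_(j < n) stopped_increment n z0 h H y j * S z0.
    by rewrite -mulr_suml sumH mulKf// gt_eqF.
  rewrite {1}Sz -mulrBr -sumrB -mulrDr -big_split/=; congr *%R.
  apply: eq_bigr => j _; rewrite -stopped_weightM//; rewrite /y/=; ring.
rewrite (le_trans (ler_normD _ _))// lerD//; last first.
  by rewrite normrM ger0_norm// invr_ge0 ltW.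
rewrite normrM ger0_norm ?invr_ge0 ?(ltW H0)// ler_pdivrMl//.
rewrite (le_trans (ler_norm_sum _ _ _))// -[in leRHS]sumH mulr_suml ler_sum// => j _.
rewrite normrM ger0_norm ?stopped_increment_ge0//.
have [Q0|Q0] := eqVneq (Qu n z0 h j.+1) 0; last first.
  by rewrite ler_wpM2l ?stopped_increment_ge0// Sb//= ltn_ord.
suff -> : stopped_increment n z0 h H y j = 0 by rewrite !mul0r.
apply/le_anti; rewrite stopped_increment_ge0 andbT.
by rewrite (le_trans (stopped_increment_le _ _ _ _ _ _))// Q0 mul0r.
Qed.

(** * Exponential moments of the stopped noise and of the energy *)

(** Written through [x / x ^ 2], the inverse only involves the real power of a
    nonnegative number, which is known to be measurable. *)
Lemma measurable_funV d (T : measurableType d) (R : realType) (f : T -> R) :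
  measurable_fun setT f -> measurable_fun setT (fun x => (f x)^-1).
Proof.
move=> mf.
have -> : (fun x => (f x)^-1) = (fun x => f x * (f x ^+ 2) `^ (-1)).
  apply/funext => x; rewrite powR_inv1 ?sqr_ge0//.
  by have [->|fx] := eqVneq (f x) 0; [rewrite invr0 mul0r|field].
apply: measurable_funM => //.
apply: (measurableT_comp (f := fun z : R => z `^ (-1))); first exact: measurable_powR.
exact: measurable_funX.
Qed.

Section stochastic.
Context (R : realType) (d : measure_display) (T : measurableType d).
Variables (P : probability T R) (noise : nat -> {RV P >-> R}).
Variables (n : nat) (S : R -> R) (z0 h : R).

Let y w := observation n S (fun k => noise k w).

Lemma measurable_observation k :
  measurable_fun setT ((fun w => y w k) : past noise k -> R).
Proof.
elim: k => [|k IH]; first exact: measurable_cst.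
apply: measurable_funD; last by apply: measurable_noise_past; rewrite /= leqnn.
by apply: measurable_funM => //; apply: (measurable_past_homo (leqnSn k)).
Qed.

Lemma measurable_A_past k l : (k <= l.+1)%N ->
  measurable_fun setT ((fun w => A n z0 h (y w) k) : past noise l -> R).
Proof.
elim: k => [|k IH] kl; first by under eq_fun do rewrite A_at0; exact: measurable_cst.
under eq_fun do rewrite A_rec.
apply: measurable_funD; first by apply: IH; exact: ltnW.
apply: measurable_funM => //; apply: measurable_funX.
apply: (@measurable_past_homo _ _ _ _ noise k l) => //.
exact: measurable_observation.
Qed.

Lemma measurable_stopped_weight H j :
  measurable_fun setT ((fun w => stopped_weight n z0 h H (y w) j) : past noise j -> R).
Proof.
apply: measurable_funM.
  by apply: measurable_funB; apply: measurable_minr => //; exact: measurable_A_past.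
apply: (@measurable_funV _ (past noise j) R (fun w => y w j)).
exact: measurable_observation.
Qed.

Definition stopped_noise H w : R :=
  \sum_(j < n) stopped_weight n z0 h H (y w) j * noise j.+1 w.

Lemma measurable_stopped_noise H : measurable_fun setT (stopped_noise H).
Proof.
apply: measurable_sum => j; apply: measurable_funM => //.
by apply: (@measurable_past_fun _ _ _ _ noise j); exact: measurable_stopped_weight.
Qed.

Lemma measurable_A : measurable_fun setT (fun w => A n z0 h (y w) n).
Proof.
by apply: (@measurable_past_fun _ _ _ _ noise n); apply: measurable_A_past.
Qed.

Hypothesis iid : iid_std_normal n noise.

(** The compensated exponential has conditional mean exactly 1, and the
    compensator is at most [t ^ 2 * H / 2]. *)
Lemma stopped_noise_mgf H t : 0 < H ->
  (\int[P]_w (expR (t * stopped_noise H w))%:E <= (expR (t ^+ 2 * H / 2))%:E)%E.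
Proof.
move=> H0.
pose G j (z : T * R) : R := t * stopped_weight n z0 h H (y z.1) j * z.2
  - (t * stopped_weight n z0 h H (y z.1) j) ^+ 2 / 2.
have mG j : measurable_fun setT (G j : past noise j * R -> R).
  have mw : measurable_fun setT ((fun z => t * stopped_weight n z0 h H (y z.1) j)
      : past noise j * R -> R).
    apply: measurable_funM => //.
    apply: (@measurableT_comp _ _ _ _ _ _
      ((fun w => stopped_weight n z0 h H (y w) j) : past noise j -> R) _
      (fst : past noise j * R -> past noise j)); first exact: measurable_stopped_weight.
    exact: measurable_fst.
  apply: measurable_funB; first exact: measurable_funM.
  by apply: measurable_funM => //; exact: measurable_funX.
have := @exp_supermartingale _ _ _ P noise n iid G (fun=> 0) n (leqnn n).
rewrite big1// expR0 => EG.
rewrite -[leRHS]mule1; apply: (@le_trans _ _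
  ((expR (t ^+ 2 * H / 2))%:E * \int[P]_w (expR (\sum_(j < n) G j (w, noise j.+1 w)))%:E)%E).
  rewrite -ge0_integralZl ?lee_fin ?expR_ge0//; last first.
    apply/measurable_EFinP; apply: measurableT_comp => //.
    by apply: (@measurable_past_fun _ _ _ _ noise n); exact: measurable_past_sum.
  apply: le_integral_ge0 => w; first by rewrite lee_fin expR_ge0.
  rewrite -EFinM lee_fin -expRD ler_expR.
  have -> : \sum_(j < n) G j (w, noise j.+1 w) = t * stopped_noise H w
      - t ^+ 2 * (\sum_(j < n) stopped_weight n z0 h H (y w) j ^+ 2) / 2.
    rewrite /stopped_noise !mulr_sumr mulr_suml -sumrB.
    by apply: eq_bigr => j _; rewrite /G/=; ring.
  have := sum_stopped_weight_sqr n z0 h (y w) H0 => /(ler_wpM2l (sqr_ge0 t)).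
  lra.
rewrite lee_wpmul2l ?lee_fin ?expR_ge0// EG// => j w _.
rewrite le_eqVlt; apply/orP; left; apply/eqP; rewrite /G/=.
exact: normal_mgf.
Qed.

(** The first term of [A] carries [y 0 = 0], hence the shift by 2: design point
    [j.+2] contributes [y j.+1 ^ 2], where [y j.+1] is normal with variance 1
    given the past. *)
Lemma A_laplace :
  (\int[P]_w (expR (- (2^-1 * A n z0 h (y w) n)))%:E
   <= (expR (- (ln 2 / 2 * \sum_(j < n.-1) Qu n z0 h j.+2)))%:E)%E.
Proof.
pose G j (z : T * R) : R :=
  - (2^-1 * (Qu n z0 h j.+2 * (S (design R n j.+1) * y z.1 j + z.2) ^+ 2)).
have mG j : measurable_fun setT (G j : past noise j * R -> R).
  apply: measurableT_comp => //; apply: measurable_funM => //; apply: measurable_funM => //.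
  apply: measurable_funX; apply: measurable_funD => //.
  apply: measurable_funM => //.
  apply: (@measurableT_comp _ _ _ _ _ _ ((fun w => y w j) : past noise j -> R) _
      (fst : past noise j * R -> past noise j)); first exact: measurable_observation.
  exact: measurable_fst.
have := @exp_supermartingale _ _ _ P noise n iid G
  (fun j => - (ln 2 / 2 * Qu n z0 h j.+2)) n.-1 (leq_pred n).
rewrite sumrN -mulr_sumr => EG.
have AG w : - (2^-1 * A n z0 h (y w) n) = \sum_(j < n.-1) G j (w, noise j.+1 w).
  rewrite sumrN -mulr_sumr; congr (- (_ * _)); rewrite /A.
  have [n0|n0] := posnP n.
    by rewrite big_geq ?n0// [RHS]big1// => -[].
  by rewrite big_add1/= big_ltn// expr0n mulr0 add0r big_add1 big_mkord.
under eq_integral do rewrite AG.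
apply: EG => // j w _; rewrite /G/=.
have [->|Q1] := eqVneq (Qu n z0 h j.+2) 0.
  under eq_integral do rewrite mul0r mulr0 oppr0 expR0.
  by rewrite mulr0 oppr0 expR0 integral_cst//= probability_setT mule1.
have -> : Qu n z0 h j.+2 = 1 by apply: (mulfI Q1); rewrite Qu_idem mulr1.
under eq_integral do rewrite mul1r.
by rewrite mulr1; exact: normal_laplace_square.
Qed.

Lemma stopped_noise_abs_mgf H t : 0 < H ->
  (\int[P]_w (expR (t * (`|stopped_noise H w| / Num.sqrt H)))%:E
   <= (2 * expR (t ^+ 2 / 2))%:E)%E.
Proof.
move=> H0; have sH : Num.sqrt H != 0 by rewrite gt_eqF// sqrtr_gt0.
have bound s : s ^+ 2 = t ^+ 2 / H ->
    (\int[P]_w (expR (s * stopped_noise H w))%:E <= (expR (t ^+ 2 / 2))%:E)%E.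
  move=> s2; rewrite (le_trans (stopped_noise_mgf _ _))// s2.
  by rewrite divfK// gt_eqF.
have me s : measurable_fun setT (fun w => (expR (s * stopped_noise H w))%:E).
  apply/measurable_EFinP; apply: measurableT_comp => //.
  by apply: measurable_funM => //; exact: measurable_stopped_noise.
apply: (@le_trans _ _ (\int[P]_w ((expR (t / Num.sqrt H * stopped_noise H w))%:E
    + (expR (- (t / Num.sqrt H) * stopped_noise H w))%:E))%E).
  apply: le_integral_ge0 => w; first by rewrite lee_fin expR_ge0.
  rewrite -EFinD lee_fin mulrA mulrAC.
  case: (ger0P (stopped_noise H w)) => _; first by rewrite lerDl expR_ge0.
  by rewrite mulrN -mulNr lerDr expR_ge0.
rewrite ge0_integralD//; try by move=> w _; rewrite lee_fin expR_ge0.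
have -> : 2 * expR (t ^+ 2 / 2) = expR (t ^+ 2 / 2) + expR (t ^+ 2 / 2) by ring.
by rewrite EFinD leeD// bound// ?sqrrN exprMn exprVn sqr_sqrtr// ltW.
Qed.

End stochastic.

(** * The energy in the window exceeds [n h] *)

(** One application of [ln (1 + x) <= x] only gives the weak inequality; two,
    along [1 / 2 = 3 / 4 * (2 / 3)], give [7 / 12]. *)
Lemma ln2_gt_half (R : realType) : 2^-1 < ln 2 :> R.
Proof.
have h1 : ln (3 / 4 : R) <= - (1 / 4).
  by rewrite (_ : 3 / 4 = 1 + - (1 / 4) :> R); [apply: le_ln1Dx; lra|field].
have h2 : ln (2 / 3 : R) <= - (1 / 3).
  by rewrite (_ : 2 / 3 = 1 + - (1 / 3) :> R); [apply: le_ln1Dx; lra|field].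
have : ln (2 : R) = - (ln (3 / 4) + ln (2 / 3)).
  rewrite -lnM ?posrE; [|lra|lra].
  by rewrite -lnV ?posrE; [congr ln; field|lra].
lra.
Qed.

Section window.
Variables (R : realType) (n : nat) (z0 h : R).
Hypothesis h_gt0 : 0 < h.

Lemma QuE j : (0 < n)%N ->
  Qu n z0 h j = (n%:R * (z0 - h) <= j%:R <= n%:R * (z0 + h))%R%:R.
Proof.
move=> n0; have n0' : 0 < n%:R :> R by rewrite ltr0n.
rewrite /Qu indicE mem_setE in_itv/= /design.
congr (nat_of_bool (_ && _))%:R.
  rewrite ler_pdivlMr// mulN1r lerBrDr addrC -[RHS](ler_pM2l (x := n%:R^-1)) ?invr_gt0//.
  by rewrite mulKf ?gt_eqF// mulrC.
rewrite ler_pdivrMr// mul1r lerBlDr addrC -[RHS](ler_pM2l (x := n%:R^-1)) ?invr_gt0//.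
by rewrite mulKf ?gt_eqF// mulrC.
Qed.

Lemma Qu_dist j : (0 < n)%N -> Qu n z0 h j != 0 -> `|design R n j - z0| <= h.
Proof.
move=> n0; rewrite QuE// pnatr_eq0 eqb0 negbK => /andP[a b].
have n0' : 0 < n%:R :> R by rewrite ltr0n.
rewrite /design ler_distl ler_pdivlMr// ler_pdivrMr//.
by rewrite ![_ * n%:R]mulrC a b.
Qed.

(** The hypotheses place the window inside the design and away from its first
    point; an interval of length [2 n h] contains at least [2 n h - 1]
    integers. *)
Lemma window_count : 1 < n%:R * (z0 - h) -> z0 + h <= 1 ->
  2 * n%:R * h - 1 <= \sum_(j < n.-1) Qu n z0 h j.+2.
Proof.
move=> a1 b1; set a := n%:R * (z0 - h) in a1 *; pose b := n%:R * (z0 + h).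
have n0 : (0 < n)%N.
  by rewrite lt0n; apply: contraTneq a1 => n0; rewrite /a n0 mul0r -leNgt ler01.
have n0' : 0 < n%:R :> R by rewrite ltr0n.
have ab : a <= b by rewrite /a /b ler_pM2l//; move: h_gt0; lra.
have bn : b <= n%:R by rewrite /b -[leRHS]mulr1 ler_pM2l.
have a0 : 0 <= a by lra.
have b0 : 0 <= b by lra.
(* The integers from [k.+1] to [l] are the ones counted. *)
pose k := Num.truncn a; pose l := Num.truncn b.
have [ka ak] : k%:R <= a /\ a < k.+1%:R by apply/andP; exact: truncn_itv.
have [lb bl] : l%:R <= b /\ b < l.+1%:R by apply/andP; exact: truncn_itv.
have k1 : (1 <= k)%N by rewrite truncn_ge_nat// ltW.
have kl : (k <= l)%N by exact: le_truncn.
have ln : (l <= n)%N by rewrite -(ler_nat R) (le_trans lb).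
have -> : \sum_(j < n.-1) Qu n z0 h j.+2 = \sum_(2 <= i < n.+1) Qu n z0 h i.
  by rewrite big_add1 big_add1/= big_mkord.
rewrite (big_cat_nat _ (n := k.+1))//=; last by rewrite ltnS (leq_trans kl).
rewrite (big_cat_nat _ (n := l.+1) (m := k.+1))//=.
have -> : \sum_(k.+1 <= i < l.+1) Qu n z0 h i = l%:R - k%:R.
  rewrite (eq_big_nat _ _ (F2 := fun=> 1)).
    by rewrite big_const_nat iter_addr_0 subSS natrB.
  move=> i /andP[ki il]; rewrite QuE// -/a -/b.
  rewrite (le_trans (ltW ak)) ?ler_nat//= (le_trans _ lb) ?ler_nat//.
have s1 : 0 <= \sum_(2 <= i < k.+1) Qu n z0 h i.
  by apply: sumr_ge0 => i _; exact: Qu_ge0.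
have s2 : 0 <= \sum_(l.+1 <= i < n.+1) Qu n z0 h i.
  by apply: sumr_ge0 => i _; exact: Qu_ge0.
have : b - a = 2 * n%:R * h by rewrite /a /b; ring.
have : l.+1%:R = l%:R + 1 :> R by rewrite natr1.
lra.
Qed.

End window.

(** The exponential Markov bound for the event [A n < n h], kept as an
    integral.  Twice [exp (- (ln 2 - 1 / 2) * n h)] comes from the count
    [2 n h - 1], the lost point costing a factor less than 2. *)
Lemma A_deficit (R : realType) (d : measure_display) (T : measurableType d)
    (P : probability T R) (noise : nat -> {RV P >-> R}) (n : nat) (S : R -> R)
    (z0 h : R) : iid_std_normal n noise ->
  0 < h -> 1 < n%:R * (z0 - h) -> z0 + h <= 1 ->
  (\int[P]_w (expR ((n%:R * h - A n z0 h (observation n S (fun k => noise k w)) n) / 2))%:E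
   <= (2 * expR (- ((ln 2 - 2^-1) * (n%:R * h))))%:E)%E.
Proof.
move=> iid h0 a1 b1; have count := window_count h0 a1 b1.
have L2 := ln2_gt_half R.
pose y w := observation n S (fun k => noise k w).
have E w : (expR ((n%:R * h - A n z0 h (y w) n) / 2))%:E =
    ((expR (n%:R * h / 2))%:E * (expR (- (2^-1 * A n z0 h (y w) n)))%:E)%E.
  by rewrite -EFinM -expRD; congr (expR _)%:E; ring.
under eq_integral do rewrite E.
rewrite ge0_integralZl ?lee_fin ?expR_ge0//; last first.
  apply/measurable_EFinP; apply: measurableT_comp => //.
  apply: measurableT_comp => //; apply: measurable_funM => //.
  exact: measurable_A.
apply: (le_trans (lee_wpmul2l _ (A_laplace S z0 h iid))); first by rewrite lee_fin expR_ge0.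
rewrite -EFinM lee_fin -expRD.
rewrite [leRHS](_ : _ = expR (ln 2 - (ln 2 - 2^-1) * (n%:R * h))); last first.
  by rewrite expRD lnK ?posrE.
rewrite ler_expR.
move: count; rewrite -mulrA; set W := \sum_(_ < _) _.
move: (ln 2) L2 (n%:R * h) => c c0 x xW; nra.
Qed.

(** * Rates, bandwidths and the grid *)

Section rates.
Variables (R : realType) (n : nat).
Hypothesis dn_ge1 : 1 <= dn R n.

Let dn_gt0 : 0 < dn R n. Proof. exact: lt_le_trans dn_ge1. Qed.

Lemma rate_gt0 beta : 0 < rate n beta :> R.
Proof. exact: powR_gt0. Qed.

Lemma rate_ge0 beta : 0 <= rate n beta :> R.
Proof. exact: powR_ge0. Qed.

Lemma bandwidth_gt0 beta : 0 < bandwidth n beta :> R.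
Proof. exact: powR_gt0. Qed.

Lemma rate_le (b1 b2 : R) : 0 <= b1 -> b1 <= b2 -> rate n b1 <= rate n b2.
Proof.
move=> b10 b12; apply: ler_powR => //.
rewrite ler_pdivrMr; last lra.
rewrite mulrAC ler_pdivlMr; last lra.
by nra.
Qed.

Lemma bandwidth_le (b1 b2 : R) : 0 <= b1 -> b1 <= b2 ->
  bandwidth n b1 <= bandwidth n b2.
Proof.
move=> b10 b12; apply: ler_powR => //.
by rewrite lerN2 lef_pV2 ?posrE; lra.
Qed.

Lemma bandwidth_le1 (b : R) : 0 <= b -> bandwidth n b <= 1.
Proof.
move=> b0; rewrite -[leRHS](powRr0 (dn R n)) ler_powR// oppr_le0 invr_ge0; lra.
Qed.

(** At the matching smoothness the bias bound [K * h ^ beta] is [K / rate]. *)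
Lemma bandwidth_powR (b : R) : bandwidth n b `^ b = (rate n b)^-1.
Proof. by rewrite -powRrM -powRN mulNr mulrC. Qed.

Lemma rate_ge1 (b : R) : 0 <= b -> 1 <= rate n b.
Proof.
move=> b0; rewrite -[leLHS](powRr0 (dn R n)) ler_powR// divr_ge0; lra.
Qed.

Lemma rate_sqr_le (b : R) : 0 <= b -> rate n b ^+ 2 <= dn R n.
Proof.
move=> b0; rewrite -powR_mulrn ?rate_ge0// /rate -powRrM ler1_powR//.
by rewrite mulrAC ler_pdivrMr; lra.
Qed.

Lemma mul_bandwidth (b : R) : 0 <= b -> 0 < ln n%:R :> R ->
  n%:R * bandwidth n b = ln n%:R * rate n b ^+ 2.
Proof.
move=> b0 L0; have nE : n%:R = ln n%:R * dn R n by rewrite mulrCA divff ?gt_eqF// mulr1.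
rewrite {1}nE -mulrA; congr *%R.
rewrite -powR_mulrn ?rate_ge0// /rate /bandwidth -powRrM.
rewrite -{1}[dn R n]powRr1 ?(ltW dn_gt0)// -powRD ?(gt_eqF dn_gt0) ?implybT//.
by congr powR; field; lra.
Qed.

(** The exponent [beta / (2 beta + 1)] is 1-Lipschitz on the half-line. *)
Lemma rate_close (b1 b2 : R) : 0 <= b1 -> b1 <= b2 -> (b2 - b1) * ln (dn R n) <= 1 ->
  rate n b2 <= expR 1 * rate n b1.
Proof.
move=> b10 b12 close; rewrite /rate /powR (gt_eqF dn_gt0) -expRD ler_expR.
rewrite -lerBlDr -mulrBl (le_trans _ close)// ler_wpM2r ?ln_ge0//.
have -> : b2 / (2 * b2 + 1) - b1 / (2 * b1 + 1) = (b2 - b1) / ((2 * b2 + 1) * (2 * b1 + 1)).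
  by field; apply/andP; split; lra.
have c : 0 < (2 * b2 + 1) * (2 * b1 + 1) by apply: mulr_gt0; lra.
rewrite ler_pdivrMr// ler_peMr ?subr_ge0//.
by have : 0 <= b2 by [exact: le_trans b12]; nra.
Qed.

Variables (blo bhi : R).
Hypotheses (blo_gt0 : 0 < blo) (blo_lt : blo < bhi) (bhi_le1 : bhi <= 1).

Local Notation m := (grid_size R n).
Local Notation b_ := (beta_ n blo bhi).

Lemma grid_size_gt0 : 0 < m%:R :> R.
Proof. by rewrite ltr0n. Qed.

Lemma beta_blo k : blo <= b_ k.
Proof.
rewrite lerDl; apply: mulr_ge0; first by rewrite divr_ge0.
by rewrite subr_ge0 ltW.
Qed.

Lemma beta_ge0 k : 0 <= b_ k.
Proof. by rewrite (le_trans (ltW blo_gt0))// beta_blo. Qed.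

Lemma beta_homo k l : (k <= l)%N -> b_ k <= b_ l.
Proof.
move=> kl; rewrite lerD2l; apply: ler_wpM2r; first by rewrite subr_ge0 ltW.
by rewrite ler_wpM2r ?invr_ge0 ?ler0n// ler_nat.
Qed.

Lemma beta_bhi k : (k <= m)%N -> b_ k <= bhi.
Proof.
move=> km; have bm : b_ m = bhi by rewrite /beta_ divff ?gt_eqF ?grid_size_gt0//; ring.
by rewrite -[leRHS]bm; exact: beta_homo.
Qed.

(** The grid has more than [ln (dn R n)] cells, so a step of the grid moves the
    exponent by less than the inverse of [ln (dn R n)]. *)
Lemma N_close k : N_ n blo bhi k.+1 <= expR 1 * N_ n blo bhi k.
Proof.
apply: rate_close; [exact: beta_ge0|exact: beta_homo|].
have -> : b_ k.+1 - b_ k = (bhi - blo) / m%:R.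
  by rewrite /beta_ -natr1; field; rewrite gt_eqF ?grid_size_gt0.
rewrite mulrAC ler_pdivrMr ?grid_size_gt0// mul1r.
have L0 : 0 <= ln (dn R n) by rewrite ln_ge0.
have /andP[_ Lm] := truncn_itv L0.
by apply: le_trans (ltW Lm); rewrite ler_piMl//; move: blo_gt0 blo_lt bhi_le1; lra.
Qed.

Lemma grid_bracket beta : blo <= beta <= bhi ->
  exists2 i, (i <= m)%N & b_ i <= beta <= b_ i.+1.
Proof.
have := blo_lt; move=> bl /andP[lo hi]; pose x := (beta - blo) / (bhi - blo) * m%:R.
have x0 : 0 <= x.
  by apply: mulr_ge0 => //; apply: divr_ge0; lra.
have /andP[ix xi] := truncn_itv x0.
have m0 := grid_size_gt0.
have bE : beta = blo + x / m%:R * (bhi - blo).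
  by rewrite /x; field; rewrite gt_eqF//= gt_eqF//; lra.
exists (Num.truncn x).
  rewrite -(ler_nat R) (le_trans ix)// ler_piMl ?ler0n// ler_pdivrMr; lra.
by rewrite [in X in _ && X]bE {1}bE !lerD2l !ler_pM2r ?invr_gt0 ?subr_gt0// ix ltW.
Qed.

End rates.

(** * Lepski's selection rule on a good outcome *)

Lemma first_inP (k : nat) (p : pred nat) :
  let j := first_in 0 k p in
  [/\ (j <= k.+1)%N, forall i, (i < j)%N -> ~~ p i & (j <= k)%N -> p j].
Proof.
rewrite /first_in add0n subn0; split.
- by rewrite (leq_trans (find_size _ _))// size_iota.
- move=> i ij; have := before_find 0%N ij; rewrite nth_iota ?add0n => [->//|].
  by rewrite (leq_trans ij)// (leq_trans (find_size _ _))// size_iota.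
- move=> jk; have hp : has p (iota 0 k.+1) by rewrite has_find size_iota.
  by have := nth_find 0%N hp; rewrite nth_iota.
Qed.

Section lepski.
Variables (R : realType) (n : nat) (z0 blo bhi lambda : R) (y : nat -> R).
Hypothesis dn_ge1 : 1 <= dn R n.
Hypotheses (blo_gt0 : 0 < blo) (blo_lt : blo < bhi) (bhi_le1 : bhi <= 1).
Hypothesis lambda_gt0 : 0 < lambda.

Local Notation m := (grid_size R n).
Local Notation N k := (N_ n blo bhi k).
Local Notation est k := (Sstar_h n z0 y (h_ n blo bhi k)).
Local Notation khat := (khat n z0 blo bhi lambda y).

Let N0 k : 0 < N k. Proof. exact: rate_gt0. Qed.

Let dev_self k : deviation n z0 blo bhi lambda y k k < 0.
Proof. by rewrite /deviation subrr normr0 sub0r oppr_lt0 divr_gt0. Qed.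

Lemma khat_le : (khat <= m)%N.
Proof.
rewrite /Defs.khat; case: (first_inP m
  (fun j => lambda / N j <= omega n z0 blo bhi lambda y j)).
by case: (first_in _ _ _).
Qed.

Lemma N_homo k l : (k <= l)%N -> N k <= N l.
Proof.
by move=> kl; apply: (rate_le dn_ge1); [exact: beta_ge0|exact: beta_homo].
Qed.

(** Smoothness [beta >= beta_i] bounds the bias of each estimator [k <= i] by
    [K / N_l] for every [l] between [k] and [i].  Taking [l = k.+1] matches the
    shifted threshold [lambda / N_(k+1)], and [N_(k+1) <= e N_k] absorbs the
    noise term; so no index up to [i] is rejected, and the test accepted at
    [khat] compares its estimator with the [i]-th one. *)
Lemma lepski_oracle (theta r beta K : R) (i : nat) :
  (i <= m)%N -> 0 <= K -> 0 <= r -> K + expR 1 * r <= lambda -> beta_ n blo bhi i <= beta ->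
  (forall k, (k <= m)%N -> `|est k - theta| < K * h_ n blo bhi k `^ beta + r / N k) ->
  `|adaptive_estimator n z0 blo bhi lambda y - theta| <= (2 * lambda + K + r) / N i.
Proof.
move=> im K0 r0 Kl ib err.
have hb k l : (k <= l)%N -> (l <= i)%N -> h_ n blo bhi k `^ beta <= (N l)^-1.
  move=> kl li; rewrite -bandwidth_powR.
  have b0 := beta_ge0 n blo_gt0 blo_lt.
  have bl : beta_ n blo bhi l <= beta by rewrite (le_trans _ ib)// beta_homo.
  apply: (@le_trans _ _ (h_ n blo bhi l `^ beta)).
    apply: ge0_ler_powR; rewrite ?nnegrE ?powR_ge0 ?(le_trans (b0 l))//.
    by apply: bandwidth_le => //; exact: beta_homo.
  rewrite /h_; have := bandwidth_le1 dn_ge1 (b0 l).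
  have := bandwidth_gt0 dn_ge1 (beta_ n blo bhi l); set x := bandwidth _ _ => x0 x1.
  by rewrite /powR gt_eqF// ler_expR ler_wnM2r// ln_le0.
pose p j := lambda / N j <= omega n z0 blo bhi lambda y j.
have np j : (j <= i)%N -> ~~ p j.
  move=> ji; rewrite -ltNge /omega.
  have dev k : (k <= j)%N -> deviation n z0 blo bhi lambda y j k < lambda / N j.
    rewrite leq_eqVlt => /predU1P[->|kj].
      by rewrite (lt_trans (dev_self j))// divr_gt0.
    rewrite /deviation ltrBlDr.
    have ej : `|est j - theta| < lambda / N j.
      apply: (lt_le_trans (err _ (leq_trans ji im))).
      rewrite (le_trans (lerD (ler_wpM2l K0 (hb _ _ (leqnn j) ji)) (lexx _)))//.
      rewrite -mulrDl ler_wpM2r ?invr_ge0 ?(ltW (N0 _))//; apply: le_trans Kl.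
      by rewrite lerD2l ler_peMl// -expR0 ler_expR.
    have ek : `|est k - theta| < lambda / N k.+1.
      apply: (lt_le_trans (err _ (leq_trans (ltnW kj) (leq_trans ji im)))).
      have N1 := N_close dn_ge1 blo_gt0 blo_lt bhi_le1 k.
      have rN : r / N k <= expR 1 * r / N k.+1.
        rewrite ler_pdivrMr// mulrAC ler_pdivlMr//.
        by have := ler_wpM2l r0 N1; lra.
      rewrite (le_trans (lerD (ler_wpM2l K0 (hb _ _ (leqnSn k) (leq_trans kj ji))) rN))//.
      by rewrite -mulrDl ler_wpM2r ?invr_ge0 ?(ltW (N0 _)).
    have -> : est j - est k = (est j - theta) - (est k - theta) by ring.
    by rewrite (le_lt_trans (ler_normB _ _))// ltrD.
  rewrite big_nat_cond; apply: bigmax_lt; first exact: dev.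
  by move=> k /andP[kj _]; apply: dev.
have [] := first_inP m p; rewrite -/p.
set J := first_in 0 m p => Jm Jlt JP.
have iJ : (i < J)%N.
  by rewrite ltnNge; apply/negP => Ji; have := np _ Ji; rewrite JP// (leq_trans Ji).
have khatE : khat = J.-1 by [].
have ik : (i <= khat)%N by rewrite khatE -ltnS prednK// (leq_trans _ iJ).
have kJ : (khat < J)%N by rewrite khatE prednK// (leq_trans _ iJ).
have := Jlt _ kJ; rewrite /p -ltNge => om.
have dev : deviation n z0 blo bhi lambda y khat i <= omega n z0 blo bhi lambda y khat.
  by apply: le_bigmax_seq; rewrite // mem_index_iota.
have d1 : `|est khat - est i| <= 2 * lambda / N i.
  have : `|est khat - est i| < lambda / N khat + lambda / N i.+1.
    by rewrite -ltrBlDr; exact: le_lt_trans om.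
  have h1 : lambda / N khat <= lambda / N i.
    by rewrite ler_wpM2l ?(ltW lambda_gt0)// lef_pV2 ?posrE// N_homo.
  have h2 : lambda / N i.+1 <= lambda / N i.
    by rewrite ler_wpM2l ?(ltW lambda_gt0)// lef_pV2 ?posrE// N_homo.
  lra.
rewrite /adaptive_estimator.
have -> : est khat - theta = (est khat - est i) + (est i - theta) by ring.
rewrite (le_trans (ler_normD _ _))//.
have := err i im; have := ler_wpM2l K0 (hb _ _ (leqnn i) (leqnn i)).
lra.
Qed.

End lepski.

(** * Consequences of the Holder condition *)

Section holder.
Variables (R : realType) (beta z0 K eps : R) (S : R -> R).
Hypothesis S_holder : holder_class beta z0 K eps S.
Hypothesis z0_in : 0 < z0 < 1.

Lemma holder_abs_le1 : 0 < eps -> `|S z0| <= 1.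
Proof.
move=> e0; case: S_holder => -[_ Ssup] _.
suff : `|S z0| <= 1 - eps by lra.
rewrite -lee_fin (le_trans _ Ssup)//; apply: ereal_sup_ubound.
exists z0 => //=; rewrite in_itv/=; case/andP: z0_in => -> /ltW -> //.
Qed.

Lemma holder_le x : 0 < beta -> 0 < x <= 1 -> `|S x - S z0| <= K * `|x - z0| `^ beta.
Proof.
move=> b0 x01; have [->|xz] := eqVneq x z0.
  by rewrite !subrr normr0 powR0 ?gt_eqF// mulr0.
have d0 : 0 < `|x - z0| by rewrite normr_gt0 subr_eq0.
case: S_holder => _ Ssup; rewrite -ler_pdivrMr ?powR_gt0//.
rewrite -lee_fin (le_trans _ Ssup)//; apply: ereal_sup_ubound.
by exists x => //=; rewrite in_itv/=.
Qed.

End holder.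

(** * A calculus of upper bounds for expectations *)

Section mean_le.
Context (R : realType) (d : measure_display) (T : measurableType d).
Variable P : probability T R.
Implicit Types (f g : T -> R) (a b : R).

(** Measurability and sign travel with the bound because additivity of the
    integral relies on them. *)
Definition mean_le f a : Prop :=
  [/\ measurable_fun setT f, forall w, 0 <= f w & (\int[P]_w (f w)%:E <= a%:E)%E].

Lemma mean_le_cst a : 0 <= a -> mean_le (fun=> a) a.
Proof.
move=> a0; split => //.
by rewrite integral_cst//= probability_setT mule1.
Qed.

Lemma mean_leD f g a b : mean_le f a -> mean_le g b -> mean_le (f \+ g) (a + b).
Proof.
move=> [mf f0 fa] [mg g0 gb]; split; first exact: measurable_funD.
  by move=> w; exact: addr_ge0.
under eq_integral do rewrite EFinD.
rewrite ge0_integralD//; first by rewrite EFinD leeD.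
- by move=> w _; rewrite lee_fin.
- exact/measurable_EFinP.
- by move=> w _; rewrite lee_fin.
- exact/measurable_EFinP.
Qed.

Lemma mean_leZ f a b : 0 <= b -> mean_le f a -> mean_le (fun w => b * f w) (b * a).
Proof.
move=> b0 [mf f0 fa]; split; first exact: measurable_funM.
  by move=> w; exact: mulr_ge0.
under eq_integral do rewrite EFinM.
rewrite ge0_integralZl//; first by rewrite EFinM lee_wpmul2l ?lee_fin.
- exact/measurable_EFinP.
- by move=> w _; rewrite lee_fin.
Qed.

Lemma mean_le_sum k (f : 'I_k -> T -> R) a :
  (forall i, mean_le (f i) a) -> mean_le (fun w => \sum_(i < k) f i w) (k%:R * a).
Proof.
elim: k f => [|k IH] f fa.
  under eq_fun do rewrite big_ord0; rewrite mul0r; exact: mean_le_cst.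
under eq_fun do rewrite big_ord_recr/=.
rewrite -natr1 mulrDl mul1r; apply: mean_leD => //.
exact: IH.
Qed.

Lemma mean_le_weaken f a b : a <= b -> mean_le f a -> mean_le f b.
Proof. by move=> ab [mf f0 fa]; split => //; rewrite (le_trans fa). Qed.

End mean_le.

(** * The risk at one sample size *)

Section risk.
Context (R : realType) (d : measure_display) (T : measurableType d).
Variables (P : probability T R) (noise : nat -> {RV P >-> R}) (n : nat).
Hypothesis iid : iid_std_normal n noise.
Variables (z0 K eps blo bhi lambda r : R).
Hypotheses (z0_in : 0 < z0 < 1) (K_ge0 : 0 <= K) (eps_gt0 : 0 < eps).
Hypotheses (blo_gt0 : 0 < blo) (blo_lt : blo < bhi) (bhi_le1 : bhi <= 1).
Hypotheses (r_ge0 : 0 <= r) (r2_ge4 : 4 <= r ^+ 2).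
Hypothesis lambda_ge : K + expR 1 * r <= lambda.
Hypothesis lambda_gt0 : 0 < lambda.
Hypothesis dn_ge1 : 1 <= dn R n.
Hypothesis ln_ge1 : 1 <= ln n%:R :> R.
Hypothesis left_window : 1 < n%:R * (z0 - bandwidth n bhi).
Hypothesis right_window : z0 + bandwidth n bhi <= 1.
Hypothesis rate_large : 2 <= (ln 2 - 2^-1) * rate n blo ^+ 2.

Variables (beta : R) (S : R -> R).
Hypothesis beta_in : blo <= beta <= bhi.
Hypothesis S_holder : holder_class beta z0 K eps S.

Local Notation m := (grid_size R n).
Local Notation N k := (N_ n blo bhi k).
Local Notation h k := (h_ n blo bhi k).
Local Notation L := (ln n%:R : R).
Local Notation y w := (observation n S (fun k => noise k w)).
Local Notation est w k := (Sstar_h n z0 (y w) (h k)).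
Local Notation risk_est w := (adaptive_estimator n z0 blo bhi lambda (y w)).
Local Notation Ak w k := (A n z0 (h k) (y w) n).

(** The modulus of a sub-Gaussian variable of variance proxy 1, by
    [stopped_noise_abs_mgf]. *)
Definition normalized_noise k w : R :=
  `|stopped_noise noise n S z0 (h k) (n%:R * h k) w| / Num.sqrt (n%:R * h k).
Local Notation Z k w := (normalized_noise k w).

Let n_gt0 : (0 < n)%N.
Proof.
by rewrite lt0n; apply/eqP => n0; move: dn_ge1; rewrite /dn n0 mul0r ler10.
Qed.

Let n_gt0R : 0 < n%:R :> R. Proof. by rewrite ltr0n. Qed.

Let L_gt0 : 0 < L. Proof. exact: lt_le_trans ln_ge1. Qed.

Let h_gt0 k : 0 < h k. Proof. exact: bandwidth_gt0. Qed.

Let H_gt0 k : 0 < n%:R * h k. Proof. exact: mulr_gt0. Qed.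

Let N_gt0 k : 0 < N k. Proof. exact: rate_gt0. Qed.

Let HE k : n%:R * h k = L * N k ^+ 2.
Proof. by apply: mul_bandwidth => //; exact: beta_ge0. Qed.

Let sqrtHE k : Num.sqrt (n%:R * h k) = Num.sqrt L * N k.
Proof. by rewrite HE sqrtrM ?ltW// sqrtr_sqr ger0_norm// ltW. Qed.

Let beta_gt0 : 0 < beta.
Proof. by case/andP: beta_in => b _; exact: lt_le_trans b. Qed.

Lemma normalized_noise_ge0 k w : 0 <= Z k w.
Proof. by rewrite divr_ge0. Qed.

Lemma Sstar_h_error w k : n%:R * h k <= Ak w k ->
  `|est w k - S z0| <= K * h k `^ beta + Z k w / Num.sqrt L / N k.
Proof.
move=> HA; apply: le_trans.
  apply: (@Sstar_error _ _ _ _ _ (K * h k `^ beta)) => // j /andP[j1 jn] Qj.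
  apply: (le_trans (holder_le S_holder beta_gt0 _)).
    by rewrite divr_gt0 ?ltr0n//= ler_pdivrMr// mul1r ler_nat.
  apply: ler_wpM2l => //; apply: ge0_ler_powR;
    rewrite ?nnegrE ?(ltW beta_gt0) ?(ltW (h_gt0 k))//.
  exact: (Qu_dist (h_gt0 k) n_gt0 Qj).
rewrite lerD2l /normalized_noise -mulrA -mulrA -invfM -sqrtHE -invfM -expr2.
rewrite (sqr_sqrtr (ltW (H_gt0 k))) mulrC.
exact: lexx.
Qed.

(** If [A n < n h] the estimator is 0 and its error is [|S z0| <= 1]; otherwise
    bandwidth at most 1 and rate at least 1 make the error bound crude. *)
Lemma crude_error w k : (k <= m)%N -> `|est w k - S z0| <= 1 + K + Z k w.
Proof.
move=> km; have Z0 := normalized_noise_ge0 k w.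
have [HA|HA] := leP (n%:R * h k) (Ak w k); last first.
  rewrite /Sstar_h /Sstar (lt_geF HA) sub0r normrN.
  by rewrite (le_trans (holder_abs_le1 S_holder z0_in eps_gt0))//; move: K_ge0; lra.
rewrite (le_trans (Sstar_h_error HA))//.
have hb : h k `^ beta <= 1.
  have -> : 1 = 1 `^ beta :> R by rewrite powR1.
  apply: ge0_ler_powR.
  - exact: ltW beta_gt0.
  - by rewrite nnegrE ltW.
  - by rewrite nnegrE.
  - by apply: (bandwidth_le1 dn_ge1); exact: beta_ge0.
have N1 : 1 <= N k by apply: (rate_ge1 dn_ge1); exact: beta_ge0.
have sL1 : 1 <= Num.sqrt L by rewrite -[leLHS]sqrtr1 ler_wsqrtr.
have : Z k w / Num.sqrt L / N k <= Z k w.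
  rewrite -mulrA -invfM ler_pdivrMr ?mulr_gt0 ?sqrtr_gt0//.
  by rewrite ler_peMr// mulr_ege1.
have := ler_wpM2l K_ge0 hb; lra.
Qed.

Lemma good_error w :
  (forall k, (k <= m)%N -> n%:R * h k <= Ak w k /\ Z k w < r * Num.sqrt L) ->
  rate n beta * `|risk_est w - S z0| <= expR 1 * (2 * lambda + K + r).
Proof.
move=> good; have [i im /andP[ib bi]] := grid_bracket n blo_lt beta_in.
have oracle : `|risk_est w - S z0| <= (2 * lambda + K + r) / N i.
  apply: (lepski_oracle dn_ge1 blo_gt0 blo_lt bhi_le1 lambda_gt0
    im K_ge0 r_ge0 lambda_ge ib) => k km.
  have [HA Zr] := good k km; rewrite (le_lt_trans (Sstar_h_error HA))// ltrD2l.
  by rewrite ltr_pM2r ?invr_gt0// ltr_pdivrMr// sqrtr_gt0.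
have rN : rate n beta <= expR 1 * N i.
  apply: le_trans (N_close dn_ge1 blo_gt0 blo_lt bhi_le1 i).
  by apply: (rate_le dn_ge1) => //; exact: ltW beta_gt0.
have c0 : 0 <= 2 * lambda + K + r.
  by move: lambda_gt0 K_ge0 r_ge0; lra.
apply: (le_trans (ler_pM (rate_ge0 _ _) (normr_ge0 _) rN oracle)).
by rewrite -mulrA [N i * _]mulrC divfK// gt_eqF.
Qed.

(** The first sum bounds the indicator of a bad outcome: each exponent is
    nonnegative when the corresponding event occurs.  The second sum bounds
    [Z ^ 2 / n], for whichever index is selected. *)
Definition dominating w : R := expR 1 * (2 * lambda + K + r) + rate n beta *
  ((2 + K) * n%:R * \sum_(k < m.+1) (expR ((n%:R * h k - Ak w k) / 2)
      + expR (- (r ^+ 2 * L)) * expR (r * Num.sqrt L * Z k w))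
   + 4 / n%:R * \sum_(k < m.+1) expR (1 * Z k w)).

Lemma risk_dominated w : rate n beta * `|risk_est w - S z0| <= dominating w.
Proof.
have n1 : 1 <= n%:R :> R by rewrite ler1n.
set X := fun k : 'I_m.+1 => expR ((n%:R * h k - Ak w k) / 2)
      + expR (- (r ^+ 2 * L)) * expR (r * Num.sqrt L * Z k w).
have X0 k : 0 <= X k by rewrite addr_ge0 ?mulr_ge0 ?expR_ge0.
have SX : 0 <= \sum_(k < m.+1) X k by exact: sumr_ge0.
have SZ : 0 <= \sum_(k < m.+1) expR (1 * Z k w).
  by apply: sumr_ge0 => k _; exact: expR_ge0.
have rt := rate_ge0 n beta.
have [good|] := pselect (forall k, (k <= m)%N ->
    n%:R * h k <= Ak w k /\ Z k w < r * Num.sqrt L).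
  apply: (le_trans (good_error good)); rewrite /dominating lerDl.
  by rewrite mulr_ge0// addr_ge0// mulr_ge0// ?divr_ge0// mulr_ge0// addr_ge0.
move=> /existsNP[k0 /not_implyP[k0m /not_andP bad]].
have bad1 : 1 <= \sum_(k < m.+1) X k.
  have k0m' : (k0 < m.+1)%N by [].
  rewrite (bigD1 (Ordinal k0m'))//= -[leLHS]addr0 lerD ?sumr_ge0//.
  case: bad => /negP; rewrite -?ltNge -?leNgt => b.
    apply: (@le_trans _ _ (expR ((n%:R * h k0 - Ak w k0) / 2))).
      by rewrite -[leLHS]expR0 ler_expR divr_ge0// subr_ge0 ltW.
    by rewrite lerDl mulr_ge0 ?expR_ge0.
  apply: (@le_trans _ _ (expR (- (r ^+ 2 * L)) * expR (r * Num.sqrt L * Z k0 w))).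
    rewrite -expRD -[leLHS]expR0 ler_expR addrC subr_ge0.
    rewrite -[X in r ^+ 2 * X](sqr_sqrtr (ltW L_gt0)) -exprMn expr2.
    by rewrite ler_wpM2l// mulr_ge0// sqrtr_ge0.
  by rewrite lerDr expR_ge0.
pose k1 := khat n z0 blo bhi lambda (y w).
have k1m : (k1 <= m)%N := khat_le n z0 blo bhi lambda (y w).
have Z0 := normalized_noise_ge0 k1 w.
(* From [Z <= n + Z ^ 2 / n] and [Z ^ 2 <= 4 exp Z]. *)
have Zn : Z k1 w <= n%:R + 4 / n%:R * expR (1 * Z k1 w).
  have e2 : Z k1 w ^+ 2 <= 4 * expR (Z k1 w).
    have := expR_ge1Dx (Z k1 w / 2).
    have -> : expR (Z k1 w) = expR (Z k1 w / 2) ^+ 2.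
      by rewrite -expRM_natl; congr expR; rewrite mulr_natl -mulr_natr divfK.
    by nra.
  rewrite mul1r mulrAC -lerBlDl ler_pdivlMr//.
  by nra.
have ZS : expR (1 * Z k1 w) <= \sum_(k < m.+1) expR (1 * Z k w).
  have k1m' : (k1 < m.+1)%N by [].
  by rewrite (bigD1 (Ordinal k1m'))//= lerDl sumr_ge0// => k _; exact: expR_ge0.
have C0 : 0 <= expR 1 * (2 * lambda + K + r).
  rewrite mulr_ge0 ?expR_ge0//; move: lambda_gt0 K_ge0 r_ge0; lra.
have err : `|risk_est w - S z0| <= 1 + K + Z k1 w by exact: crude_error.
have S1 : (2 + K) * n%:R <= (2 + K) * n%:R * \sum_(k < m.+1) X k.
  by rewrite ler_peMr// mulr_ge0// addr_ge0.
have S2 : 4 / n%:R * expR (1 * Z k1 w) <= 4 / n%:R * \sum_(k < m.+1) expR (1 * Z k w).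
  by rewrite ler_wpM2l// divr_ge0.
rewrite /dominating -[leLHS]add0r lerD// ler_wpM2l//.
have : 1 + K + n%:R <= (2 + K) * n%:R by move: K_ge0 => K0; nra.
move: S1; rewrite -/X; lra.
Qed.

Let n2E : expR (- (2 * L)) = (n%:R ^+ 2)^-1.
Proof. by rewrite expRN expRM_natl lnK// posrE. Qed.

Lemma deficit_mean_le k : (k <= m)%N ->
  mean_le P (fun w => expR ((n%:R * h k - Ak w k) / 2)) (2 / n%:R ^+ 2).
Proof.
move=> km; split.
- apply: measurableT_comp => //; apply: measurable_funM => //.
  by apply: measurable_funB => //; exact: measurable_A.
- by move=> w; exact: expR_ge0.
have b0 := beta_ge0 n blo_gt0 blo_lt k.
have hk : h k <= bandwidth n bhi.
  by apply: (bandwidth_le dn_ge1) => //; exact: (beta_bhi blo_lt).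
have a1 : 1 < n%:R * (z0 - h k).
  by apply: (lt_le_trans left_window); rewrite ler_pM2l// lerD2l lerN2.
have b1 : z0 + h k <= 1 by apply: le_trans right_window; rewrite lerD2l.
apply: (le_trans (A_deficit S iid (h_gt0 k) a1 b1)).
rewrite lee_fin ler_pM2l// -n2E ler_expR lerN2 HE.
have N2 : rate n blo ^+ 2 <= N k ^+ 2.
  rewrite ler_sqr ?nnegrE ?rate_ge0//; apply: (rate_le dn_ge1); first exact: ltW.
  exact: (beta_blo n blo_lt).
rewrite mulrCA mulrC ler_pM2l// (le_trans rate_large)// ler_wpM2l// subr_ge0 ltW//.
exact: ln2_gt_half.
Qed.

Lemma noise_mean_le k t :
  mean_le P (fun w => expR (t * Z k w)) (2 * expR (t ^+ 2 / 2)).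
Proof.
split.
- apply: measurableT_comp => //; apply: measurable_funM => //.
  apply: measurable_funM => //; apply: measurableT_comp => //.
  exact: measurable_stopped_noise.
- by move=> w; exact: expR_ge0.
- exact: stopped_noise_abs_mgf.
Qed.

(** The exponent [r * sqrt (ln n)] is the optimal one in the Chernoff bound; it
    leaves [exp (- r ^ 2 * ln n / 2)], and [r ^ 2 >= 4]. *)
Lemma noise_tail_mean_le k :
  mean_le P (fun w => expR (- (r ^+ 2 * L)) * expR (r * Num.sqrt L * Z k w))
    (2 / n%:R ^+ 2).
Proof.
have := mean_leZ (expR_ge0 (- (r ^+ 2 * L))) (noise_mean_le k (r * Num.sqrt L)).
apply: mean_le_weaken; rewrite mulrCA ler_pM2l// -n2E -expRD ler_expR.
rewrite exprMn sqr_sqrtr ?(ltW L_gt0)//.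
by have := ler_wpM2r (ltW L_gt0) r2_ge4; lra.
Qed.

Lemma dominating_mean_le :
  mean_le P dominating (expR 1 * (2 * lambda + K + r) + rate n beta *
    ((2 + K) * n%:R * (m.+1%:R * (2 / n%:R ^+ 2 + 2 / n%:R ^+ 2))
     + 4 / n%:R * (m.+1%:R * (2 * expR (1 ^+ 2 / 2))))).
Proof.
have c0 : 0 <= expR 1 * (2 * lambda + K + r).
  by rewrite mulr_ge0 ?expR_ge0//; move: lambda_gt0 K_ge0 r_ge0; lra.
apply: mean_leD; first exact: mean_le_cst.
apply: mean_leZ; first exact: rate_ge0.
apply: mean_leD; apply: mean_leZ.
- by rewrite mulr_ge0// addr_ge0.
- apply: (mean_le_sum (f := fun (k : 'I_m.+1) w => expR ((n%:R * h k - Ak w k) / 2)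
      + expR (- (r ^+ 2 * L)) * expR (r * Num.sqrt L * Z k w))) => k.
  by apply: mean_leD; [apply: deficit_mean_le; rewrite -ltnS|exact: noise_tail_mean_le].
- by rewrite divr_ge0.
- apply: (mean_le_sum (f := fun (k : 'I_m.+1) w => expR (1 * Z k w))) => k.
  exact: noise_mean_le.
Qed.

(** With [s = sqrt (dn R n)], the rate is at most [s] and the number of grid
    points at most [ln (s ^ 2) + 2 <= 2 s]. *)
Lemma rate_grid_le : rate n beta * m.+1%:R <= 4 * n%:R.
Proof.
have D0 : 0 < dn R n by exact: lt_le_trans dn_ge1.
pose s := Num.sqrt (dn R n).
have s1 : 1 <= s by rewrite -[leLHS]sqrtr1 ler_wsqrtr.
have s2 : s ^+ 2 = dn R n by rewrite sqr_sqrtr// ltW.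
have Rs : rate n beta <= s.
  by rewrite -(ger0_norm (rate_ge0 n beta)) -sqrtr_sqr ler_wsqrtr// rate_sqr_le// ltW.
have lnD : ln (dn R n) <= 2 * (s - 1).
  rewrite -s2 lnXn; last lra.
  have : ln s <= s - 1.
    by rewrite -[X in ln X](subrKC 1); apply: le_ln1Dx; lra.
  by rewrite mulr2n; lra.
have Dn : dn R n <= n%:R by rewrite ler_pdivrMr// ler_peMr.
have /andP[tr _] := truncn_itv (ln_ge0 dn_ge1).
have m1 : m.+1%:R <= 2 * s.
  by rewrite /grid_size -addn2 natrD; lra.
have := ler_pM (rate_ge0 _ _) (ler0n _ _) Rs m1; nra.
Qed.

(** The bound depends neither on [n] nor on [S] and [beta], which is the
    content of the theorem once the hypotheses on [n] hold eventually. *)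
Lemma risk_le :
  ((rate n beta)%:E * mean_abs_error n noise S z0
     (adaptive_estimator n z0 blo bhi lambda) <=
   (expR 1 * (2 * lambda + K + r) + 16 * (2 + K) + 32 * expR 1)%:E)%E.
Proof.
have [mD D0 meanD] := dominating_mean_le.
have rt := rate_gt0 dn_ge1 beta.
apply: (@le_trans _ _ (\int[P]_w (dominating w)%:E)%E).
  rewrite muleC -lee_pdivlMr// -ge0_integralZr//; last 3 first.
  - exact/measurable_EFinP.
  - by move=> w _; rewrite lee_fin.
  - by rewrite lee_fin invr_ge0 ltW.
  rewrite /mean_abs_error unlock; apply: le_integral_ge0 => w.
    by rewrite lee_fin.
  rewrite -EFinM lee_fin ler_pdivlMr// mulrC; exact: risk_dominated.
apply: (le_trans meanD); rewrite lee_fin -[leRHS]addrA lerD2l.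
have e12 : expR (1 ^+ 2 / 2) <= expR 1 :> R by rewrite ler_expR; lra.
have -> : rate n beta * ((2 + K) * n%:R * (m.+1%:R * (2 / n%:R ^+ 2 + 2 / n%:R ^+ 2)) +
    4 / n%:R * (m.+1%:R * (2 * expR (1 ^+ 2 / 2)))) =
    (rate n beta * m.+1%:R / n%:R) * (4 * (2 + K) + 8 * expR (1 ^+ 2 / 2)).
  by field; rewrite gt_eqF.
have q : rate n beta * m.+1%:R / n%:R <= 4 by rewrite ler_pdivrMr// rate_grid_le.
have q0 : 0 <= rate n beta * m.+1%:R / n%:R by rewrite divr_ge0// mulr_ge0// rate_ge0.
have e0 := expR_gt0 (1 ^+ 2 / 2 : R).
have c0 : 0 <= 4 * (2 + K) + 8 * expR (1 ^+ 2 / 2).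
  by move: K_ge0; lra.
apply: (le_trans (ler_wpM2r c0 q)); lra.
Qed.

End risk.

(** * Sample sizes large enough *)

Section asymptotics.
Variable R : realType.

Lemma ln_large (M : R) : \forall n \near \oo, M <= ln n%:R.
Proof.
near=> n; have : expR M <= n%:R by near: n; exact: nbhs_infty_ger.
by move=> Mn; rewrite -[leLHS]expRK ler_ln ?posrE ?expR_gt0// (lt_le_trans _ Mn) ?expR_gt0.
Unshelve. all: by end_near. Qed.

Lemma dn_large (M : R) : 0 <= M -> \forall n \near \oo, M <= dn R n.
Proof.
move=> M0; near=> n.
have L1 : 1 <= ln n%:R :> R by near: n; exact: ln_large.
have n0 : 1 <= n%:R :> R by near: n; exact: nbhs_infty_ger.
have nM : (2 * M) ^+ 2 <= n%:R by near: n; exact: nbhs_infty_ger.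
rewrite ler_pdivlMr; last lra.
pose s := Num.sqrt (n%:R : R).
have s2 : s ^+ 2 = n%:R by rewrite sqr_sqrtr//; lra.
have s1 : 1 <= s by rewrite -[leLHS]sqrtr1 ler_wsqrtr.
have sM : 2 * M <= s.
  by rewrite -[leLHS]ger0_norm ?mulr_ge0// -sqrtr_sqr ler_wsqrtr.
have : ln n%:R <= 2 * (s - 1).
  rewrite -s2 lnXn; last lra.
  have : ln s <= s - 1.
    by rewrite -[X in ln X](subrKC 1); apply: le_ln1Dx; lra.
  by rewrite mulr2n; lra.
rewrite -s2; nra.
Unshelve. all: by end_near. Qed.

Lemma dn_powR_large (p M : R) : 0 < p -> 0 <= M ->
  \forall n \near \oo, M <= dn R n `^ p.
Proof.
move=> p0 M0; near=> n.
have Mn : M `^ p^-1 <= dn R n by near: n; apply: dn_large; exact: powR_ge0.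
rewrite -[leLHS]powRr1// -(mulVf (lt0r_neq0 p0)) powRrM.
by apply: ge0_ler_powR; rewrite ?nnegrE ?powR_ge0 ?(ltW p0)// (le_trans _ Mn) ?powR_ge0.
Unshelve. all: by end_near. Qed.

Lemma rate_near (beta M : R) : 0 < beta -> 0 <= M ->
  \forall n \near \oo, M <= rate n beta.
Proof. by move=> b0 M0; apply: dn_powR_large => //; apply: divr_gt0 => //; lra. Qed.

Lemma bandwidth_near (beta delta : R) : 0 < beta -> 0 < delta ->
  \forall n \near \oo, bandwidth n beta <= delta.
Proof.
move=> b0 d0; near=> n; rewrite /bandwidth powRN -[leRHS]invrK lef_pV2 ?posrE.
- by near: n; apply: dn_powR_large; rewrite ?invr_gt0 ?invr_ge0 ?(ltW d0)//; lra.
- by apply: powR_gt0; apply: (@lt_le_trans _ _ 1) => //; near: n; exact: dn_large.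
- by rewrite invr_gt0.
Unshelve. all: by end_near. Qed.

End asymptotics.

(** * The adaptive estimator attains the rate *)

Theorem theorem2p2 (R : realType)
    (d : nat -> measure_display) (T : forall n : nat, measurableType (d n))
    (P : forall n : nat, probability (T n) R)
    (noise : forall n : nat, nat -> {RV (P n) >-> R})
    (z0 K beta_lo beta_hi lambda : R)
    (noise_iid : forall n : nat, iid_std_normal n (noise n))
    (z0_in : 0 < z0 < 1) (K_gt0 : 0 < K)
    (beta_lo_gt0 : 0 < beta_lo) (beta_lt : beta_lo < beta_hi)
    (beta_hi_le1 : beta_hi <= 1)
    (lambda_gt : K + expR 1 * Num.sqrt (4 + 4 / (2 * beta_lo + 1)) < lambda) :
  forall eps : R, 0 < eps < 1 ->
    (limn_esup (fun n : nat =>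
       adaptive_risk n (noise n) z0 K eps beta_lo beta_hi
         (adaptive_estimator n z0 beta_lo beta_hi lambda)) < +oo)%E.
Proof.
move=> eps /andP[eps0 _]; case/andP: (z0_in) => z00 z01.
have e0 : 0 < expR 1 :> R by exact: expR_gt0.
(* The largest noise level compatible with [lambda = K + e r]; the lower bound
   on [lambda] gives [r ^ 2 >= 4]. *)
pose r := (lambda - K) / expR 1.
have Er : K + expR 1 * r = lambda by rewrite /r mulrC divfK ?gt_eqF//; ring.
have c0 : 0 <= 4 / (2 * beta_lo + 1) by apply: divr_ge0; lra.
have rs : Num.sqrt (4 + 4 / (2 * beta_lo + 1)) <= r.
  by rewrite ler_pdivlMr// mulrC; lra.
have r0 : 0 <= r by rewrite (le_trans _ rs)// sqrtr_ge0.
have r2 : 4 <= r ^+ 2.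
  rewrite (@le_trans _ _ (Num.sqrt (4 + 4 / (2 * beta_lo + 1)) ^+ 2))//.
    by rewrite sqr_sqrtr; lra.
  by rewrite ler_sqr ?nnegrE ?sqrtr_ge0.
have lambda0 : 0 < lambda by have := mulr_ge0 (ltW e0) r0; lra.
pose c : R := ln 2 - 2^-1.
have cgt0 : 0 < c by rewrite subr_gt0 ln2_gt_half.
pose delta := Num.min (z0 / 2) (1 - z0).
have delta0 : 0 < delta by rewrite lt_min; apply/andP; split; lra.
have beta_hi_gt0 : 0 < beta_hi by exact: lt_trans beta_lt.
apply: (@limn_esup_lty _ _
  (expR 1 * (2 * lambda + K + r) + 16 * (2 + K) + 32 * expR 1)).
near=> n.
have dn1 : 1 <= dn R n by near: n; exact: dn_large.
have L1 : 1 <= ln n%:R :> R by near: n; exact: ln_large.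
have hd : bandwidth n beta_hi <= delta by near: n; exact: bandwidth_near.
have nz : 3 / z0 <= n%:R by near: n; exact: nbhs_infty_ger.
(* The 1 makes the rate at least 1, so that its square is at least [2 / c]. *)
have RM : 1 + 2 / c <= rate n beta_lo.
  by near: n; apply: rate_near => //; rewrite addr_ge0// divr_ge0// ltW.
apply: ge_ereal_sup => _ [beta /= beta_in <-].
apply: ge_ereal_sup => _ [S S_holder <-].
rewrite in_itv/= in beta_in.
apply: (risk_le (noise_iid n) z0_in (ltW K_gt0) eps0 beta_lo_gt0 beta_lt beta_hi_le1
   r0 r2 _ lambda0 dn1 L1 _ _ _ beta_in S_holder).
- by rewrite Er.
- move: hd; rewrite le_min => /andP[hz _].
  by move: nz; rewrite ler_pdivrMr//; nra.
- by move: hd; rewrite le_min => /andP[_ hz]; lra.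
- have c2 : 0 <= 2 / c by rewrite divr_ge0// ltW.
  have : 2 / c <= rate n beta_lo ^+ 2 by nra.
  by rewrite ler_pdivrMr// mulrC.
Unshelve. all: by end_near. Qed.
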